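(* Let $\{D_i\}_{i=1}^{\infty}$ be a sequence of domains in $\mathbb{C}^N$ and set $D:=\bigcup_j D_j$. Let $\mu\in AW(D)$ and $\mu_k\in AW(D_k)$ for $k\in\mathbb{N}$, and extend each $\mu_k$ to $D$ by setting $\mu_k:=\mu$ on $D\setminus D_k$. Assume that a) for every $n\in\mathbb{N}$ there is $N(n)\in\mathbb{N}$ such that for all $m\ge N(n)$ one has $D_n\subset D_m$ and $\mu_n(z)\le\mu_m(z)\le\mu(z)$ for $z\in D_n$; b) $\mu_k\to\mu$ as $k\to\infty$ pointwise almost everywhere on $D$. Then $\lim_{k\to\infty}K_{D_k,\mu_k}=K_{D,\mu}$ locally uniformly on $D\times D$ (that is, every compact $F\subset D\times D$ is contained in $D_k\times D_k$ for all sufficiently large $k$, and the convergence is uniform on $F$).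
   Context: A weight on an open set $D\subset\mathbb{C}^N$ is a Lebesgue measurable, real-valued, positive function on $D$ (two weights are identified if equal almost everywhere). For a weight $\mu$, $L^2(D,\mu)$ is the space of Lebesgue measurable complex-valued functions with $\|f\|_\mu^2=\int_D|f|^2\mu\,dV<\infty$ ($dV$ is Lebesgue measure), with scalar product $\langle f|g\rangle_\mu=\int_D f\overline{g}\,\mu\,dV$, and $L^2_H(D,\mu)=H(D)\cap L^2(D,\mu)$, where $H(D)$ is the space of holomorphic functions on $D$. A weight $\mu$ is admissible, written $\mu\in AW(D)$, if $L^2_H(D,\mu)$ is a closed subspace of $L^2(D,\mu)$ and for every $z\in D$ the evaluation functional $f\mapsto f(z)$ is continuous on $L^2_H(D,\mu)$. For $\mu\in AW(D)$ and $t\in D$, if the class $\{f\in L^2_H(D,\mu): f(t)=1\}$ is nonempty, it has a unique element $\phi_\mu(\cdot,t)$ of minimal norm, and the weighted Bergman kernel is $K_{D,\mu}(z,t)=\phi_\mu(z,t)/\|\phi_\mu(\cdot,t)\|_\mu^2$; if the class is empty, $K_{D,\mu}(\cdot,t)\equiv 0$. Equivalently, $K_{D,\mu}$ is the reproducing kernel of $L^2_H(D,\mu)$: $K_{D,\mu}(\cdot,t)\in L^2_H(D,\mu)$ and $f(t)=\langle f|K_{D,\mu}(\cdot,t)\rangle_\mu$ for all $f\in L^2_H(D,\mu)$. *)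

(* Defs.v *)
From HB Require Import structures.
From mathcomp Require Import all_boot all_order all_algebra.
From mathcomp Require Import complex.
From mathcomp Require Import all_classical all_reals all_analysis.

Set Implicit Arguments.
Unset Strict Implicit.
Unset Printing Implicit Defensive.

Import Order.TTheory GRing.Theory Num.Theory.
Import numFieldNormedType.Exports.

Local Open Scope classical_set_scope.
Local Open Scope ring_scope.
Local Open Scope complex_scope.

(* Iterated product measure on n-tuples, with the product sigma-algebra
   that the library puts on [n.-tuple T]. *)
Section tuple_measure.
Context {d} {T : measurableType d} {R : realType}.
Variable m : {sigma_finite_measure set T -> \bar R}.

Definition cons_tuple n (x : T * n.-tuple T) : n.+1.-tuple T :=
  [tuple of x.1 :: x.2].

Lemma measurable_cons_tuple n :
  measurable_fun [set: T * n.-tuple T] (@cons_tuple n).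
Proof. exact: measurable_cons. Qed.

Definition cons_measure n
    (p : {sigma_finite_measure set (n.-tuple T) -> \bar R}) :=
  pushforward (m \x p)%E (@cons_tuple n).

Section cons_measure_instances.
Variables (n : nat) (p : {sigma_finite_measure set (n.-tuple T) -> \bar R}).

Let cons_measure0 : cons_measure p set0 = 0%E.
Proof. by rewrite /cons_measure /pushforward preimage_set0 measure0. Qed.

Let cons_measure_ge0 A : (0 <= cons_measure p A)%E.
Proof. by rewrite /cons_measure /pushforward measure_ge0. Qed.

Let cons_measure_sigma_additive : semi_sigma_additive (cons_measure p).
Proof.
have mc := @measurable_cons_tuple n.
move=> F mF tF mUF; rewrite /cons_measure /pushforward preimage_bigcup.
apply: measure_semi_sigma_additive.
- by move=> i; rewrite -[X in measurable X]setTI; exact: mc.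
- apply/trivIsetP => /= i j _ _ ij; rewrite -preimage_setI.
  by move/trivIsetP : tF => /(_ i j I I ij) ->; rewrite preimage_set0.
- by rewrite -preimage_bigcup -[X in measurable X]setTI; exact: mc.
Qed.

HB.instance Definition _ := isMeasure.Build _ _ _ (cons_measure p)
  cons_measure0 cons_measure_ge0 cons_measure_sigma_additive.

Let cons_measure_sigma_finite : sigma_finite setT (cons_measure p).
Proof.
have [F FT mF] : sigma_finite setT (m \x p)%E.
  have /sigma_finiteP[F [TF ndF Foo]] := sigma_finiteT m.
  have /sigma_finiteP[G [TG ndG Goo]] := sigma_finiteT p.
  exists (fun k => F k `*` G k).
    rewrite -setXTT TF TG predeqE => -[x y]; split.
      move=> [/= [k _ Fx] [l _ Gy]]; exists (maxn k l) => //; split.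
      - by move: x Fx; exact/subsetPset/ndF/leq_maxl.
      - by move: y Gy; exact/subsetPset/ndG/leq_maxr.
    by move=> [k _ []/= ? ?]; split; exists k.
  move=> k; have [? ?] := Foo k; have [? ?] := Goo k.
  split; first exact: measurableX.
  by rewrite product_measure1E// lte_mul_pinfty// ge0_fin_numE.
pose g (y : n.+1.-tuple T) := (thead y, [tuple of behead y]).
have mg : measurable_fun setT g.
  apply: measurable_fun_pair => /=; first exact: measurable_tnth.
  exact: measurable_behead.
have gK : cancel (@cons_tuple n) g.
  by move=> [a b]; congr pair; apply: val_inj.
have mgF i : measurable (g @^-1` F i).
  by rewrite -[X in measurable X]setTI; apply: mg => //; exact: (mF i).1.
exists (fun i => g @^-1` F i).
  by rewrite -preimage_bigcup -FT preimage_setT.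
move=> i; split => //; rewrite /cons_measure /pushforward.
rewrite (_ : _ @^-1` _ = F i); first exact: (mF i).2.
by apply/seteqP; split => x /=; rewrite gK.
Qed.

HB.instance Definition _ := Measure_isSigmaFinite.Build _ _ _ (cons_measure p)
  cons_measure_sigma_finite.

End cons_measure_instances.

Fixpoint tuple_measure n : {sigma_finite_measure set (n.-tuple T) -> \bar R} :=
  if n is k.+1 then cons_measure (tuple_measure k) else \d_[tuple].

End tuple_measure.

Section complex_space.
Variables (R : realType) (N : nat).

Definition Cn : Type := 'rV[R[i]]_N.

HB.instance Definition _ := NormedModule.copy Cn 'rV[R[i]]_N.

(* C^N is identified with R^(N + N): real parts first, then imaginary parts. *)
Definition of_real_coord (x : (N + N).-tuple R) : Cn :=
  \row_(j < N) (tnth x (lshift N j) +i* tnth x (rshift N j)).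

Definition borel_coord_measure :
    {sigma_finite_measure
      set ((N + N).-tuple (measurableTypeR R)) -> \bar R} :=
  tuple_measure (@lebesgue_measure R) (N + N).

(* The completion of the Borel product measure; its measurable sets are the
   Lebesgue measurable subsets of R^(N + N). *)
Definition lebesgue_coord_measure :=
  @completed_measure_extension _ _ _ borel_coord_measure.

HB.instance Definition _ := Measure.on lebesgue_coord_measure.

Definition lebesgue_measurable (A : set Cn) :=
  (borel_coord_measure^*)%mu.-cara.-measurable (of_real_coord @^-1` A).

Let lebesgue_measurable0 : lebesgue_measurable set0.
Proof. by rewrite /lebesgue_measurable preimage_set0; exact: measurable0. Qed.

Let lebesgue_measurableC A :
  lebesgue_measurable A -> lebesgue_measurable (~` A).
Proof. by rewrite /lebesgue_measurable preimage_setC; exact: measurableC. Qed.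

Let lebesgue_measurable_bigcup (F : (set Cn)^nat) :
  (forall i, lebesgue_measurable (F i)) ->
  lebesgue_measurable (\bigcup_i (F i)).
Proof.
by move=> mF; rewrite /lebesgue_measurable preimage_bigcup;
  exact: bigcupT_measurable.
Qed.

Definition Cn_display : measure_display.
Proof. exact: default_measure_display. Qed.

HB.instance Definition _ := @isMeasurable.Build Cn_display Cn
  lebesgue_measurable lebesgue_measurable0 lebesgue_measurableC
  lebesgue_measurable_bigcup.

Definition lebesgue_Cn (A : set Cn) : \bar R :=
  lebesgue_coord_measure (of_real_coord @^-1` A).

Let lebesgue_Cn0 : lebesgue_Cn set0 = 0%E.
Proof. by rewrite /lebesgue_Cn preimage_set0 measure0. Qed.

Let lebesgue_Cn_ge0 A : (0 <= lebesgue_Cn A)%E.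
Proof. by rewrite /lebesgue_Cn measure_ge0. Qed.

Let lebesgue_Cn_sigma_additive : semi_sigma_additive lebesgue_Cn.
Proof.
move=> F mF tF mUF; rewrite /lebesgue_Cn preimage_bigcup.
apply: measure_semi_sigma_additive => //.
apply/trivIsetP => /= i j _ _ ij; rewrite -preimage_setI.
by move/trivIsetP : tF => /(_ i j I I ij) ->; rewrite preimage_set0.
Qed.

HB.instance Definition _ := isMeasure.Build _ _ _ lebesgue_Cn
  lebesgue_Cn0 lebesgue_Cn_ge0 lebesgue_Cn_sigma_additive.

End complex_space.

Section bergman.
Variables (R : realType) (N : nat).
Implicit Types (D : set (Cn R N)) (mu : Cn R N -> R) (f g h : Cn R N -> R[i]).

Definition domain D := [/\ D !=set0, open D & connected D].

(* Functions on D are total functions whose values outside D are never used.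
   [Cn R N] and [R[i]^o] are normed modules over R[i], so [differentiable] is
   complex (Frechet) differentiability. *)
Definition holomorphic D f :=
  forall z, D z -> differentiable (f : Cn R N -> R[i]^o) z.

Definition weight D mu :=
  measurable_fun D mu /\ forall z, D z -> 0 < mu z.

Definition L2 D mu f :=
  [/\ measurable_fun D (fun z => complex.Re (f z)),
      measurable_fun D (fun z => complex.Im (f z)) &
      (\int[@lebesgue_Cn R N]_(z in D) (Normc.normc (f z) ^+ 2 * mu z)%:E
         < +oo)%E].

Definition L2norm D mu f : R :=
  Num.sqrt (\int[@lebesgue_Cn R N]_(z in D) (Normc.normc (f z) ^+ 2 * mu z)).

Definition L2H D mu f := holomorphic D f /\ L2 D mu f.

(* L^2(D, mu) consists of classes modulo equality almost everywhere on D: an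
   element of the closure of L2H need only agree a.e. with a holomorphic
   function. *)
Definition L2H_closed D mu :=
  forall f, L2 D mu f ->
    (forall e, 0 < e ->
      exists2 h, L2H D mu h & L2norm D mu (fun z => h z - f z) < e) ->
    exists2 g, L2H D mu g & {ae @lebesgue_Cn R N, forall z, D z -> g z = f z}.

Definition evaluation_continuous D mu z :=
  forall f, L2H D mu f -> forall e, 0 < e ->
    exists2 dl, 0 < dl &
      forall g, L2H D mu g ->
        L2norm D mu (fun w => g w - f w) < dl -> Normc.normc (g z - f z) < e.

Definition admissible D mu :=
  [/\ weight D mu, L2H_closed D mu &
      forall z, D z -> evaluation_continuous D mu z].

Definition normalized_at D mu t : set (Cn R N -> R[i]) :=
  [set f | L2H D mu f /\ f t = 1].

Definition minimal_at D mu t : set (Cn R N -> R[i]) :=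
  [set f | normalized_at D mu t f /\
    forall g, normalized_at D mu t g -> L2norm D mu f <= L2norm D mu g].

(* For an admissible weight the minimal element is unique on D, so the value
   at z in D does not depend on the choice made by [xget]. *)
Definition bergman_kernel D mu (z t : Cn R N) : R[i] :=
  if `[< normalized_at D mu t !=set0 >] then
    let phi := xget (fun=> 0) (minimal_at D mu t) in
    phi z / (L2norm D mu phi ^+ 2)%:C
  else 0.

End bergman.

(* Main.v *)
Require Import Defs.
From mathcomp Require Import all_boot all_order all_algebra.
From mathcomp Require Import complex ring lra.
From mathcomp Require Import all_classical all_reals all_analysis.
From mathcomp Require Import measurable_realfun.
Import Order.TTheory GRing.Theory Num.Theory.
Import numFieldNormedType.Exports.
Local Open Scope classical_set_scope.
Local Open Scope ring_scope.
Local Open Scope complex_scope.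

Set Implicit Arguments.
Unset Strict Implicit.
Unset Printing Implicit Defensive.

Local Notation re := complex.Re.
Local Notation im := complex.Im.
Local Notation normc := Normc.normc.

(** For an admissible weight, [K(., t)] represents [h |-> Re h(t)] for the real
    inner product [Re <f|g>], and [k(t) := K(t, t)] is its squared norm.
    If [E] is contained in [D] and [nu <= mu] on [E], expanding the square gives
      [||K_E(., t) - K_D(., t)||_E^2 <= k_E(t) - k_D(t)].
    Along an increasing chain of domains and weights the kernels [K_j(., t)] are
    therefore Cauchy in each space of the chain; their limit [g] satisfies
    [g(t) = lim k_j(t)] and, by Fatou, [||g||_D^2 <= lim k_j(t)], so that
    [lim k_j(t) <= k_D(t)] by Cauchy-Schwarz for [g] and [K_D(., t)].
    Locally uniform convergence follows from
      [|K_m(z, t) - K(z, t)|^2 <= (k_m(t) - k(t)) k_n(z)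
                               <= (k_p(t) - k(t)) k_n(z)]   for [m] large,
    once [p] is chosen with [k_p(t0) - k(t0)] small, because the functions [k]
    are continuous. That continuity needs no integral formula: difference
    quotients of [t |-> K(., t)] are weakly bounded, hence bounded. *)

(** * The modulus in real coordinates *)

Lemma normc_sqr (R : rcfType) (z : R[i]) :
  normc z ^+ 2 = re z ^+ 2 + im z ^+ 2.
Proof. by case: z => a b; rewrite sqr_sqrtr // addr_ge0 // sqr_ge0. Qed.

Lemma normc_ge0 (R : rcfType) (z : R[i]) : 0 <= normc z.
Proof. by case: z => a b; exact: sqrtr_ge0. Qed.

(** * Semi-Hilbert spaces *)

Lemma le_eps (R : realType) (x y : R) :
  (forall e : R, 0 < e -> x <= y + e) -> x <= y.
Proof. by move=> H; apply/ler_addgt0Pr. Qed.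

(** For [a > 0] test the vertex [- b / a]; for [a = 0] the expression is affine in [r] and stays
    nonnegative only if [b = 0]. The degenerate case matters because seminorms are allowed below. *)
Lemma discriminant_le (R : realFieldType) (a b c : R) : 0 <= a ->
  (forall r, 0 <= r ^+ 2 * a + 2 * r * b + c) -> b ^+ 2 <= a * c.
Proof.
move=> a0 H; have [a1|a1] := eqVneq a 0; last first.
  have {}a0 : 0 < a by rewrite lt_def a1.
  have := H (- b / a).
  have -> : (- b / a) ^+ 2 * a + 2 * (- b / a) * b + c = (a * c - b ^+ 2) / a.
    by field.
  by rewrite pmulr_lge0 ?invr_gt0// subr_ge0.
rewrite {}a1 {a0} mul0r in H *.
have [->|b1] := eqVneq b 0; first by rewrite expr0n/=.
(* At this point the affine function takes the value -1. *)
have := H (- (c + 1) / (2 * b)).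
have -> : 2 * (- (c + 1) / (2 * b)) * b = - (c + 1) by field.
by lra.
Qed.

Section semi_hilbert.
Variables (R : realType) (V : lmodType R[i]).

(** [e] bounds the squared distance, so no square root enters; [converges_for] follows the same
    convention. *)
Definition cauchy_for (B : V -> V -> R) (u : nat -> V) :=
  forall e, 0 < e -> exists n, forall i j, (n <= i)%N -> (n <= j)%N ->
    B (u i - u j) (u i - u j) < e.

Definition converges_for (B : V -> V -> R) (u : nat -> V) (g : V) :=
  forall e, 0 < e -> exists n, forall i, (n <= i)%N ->
    B (u i - g) (u i - g) < e.

(* [B] is the real part of a complete, possibly degenerate, complex inner
   product on the complex subspace [H]. *)
Record semi_hilbert (H : set V) (B : V -> V -> R) : Prop := SemiHilbert {
  sh_lin : forall a f g, H f -> H g -> H (a *: f + g);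
  sh_zero : H 0;
  sh_sym : forall f g, H f -> H g -> B f g = B g f;
  sh_linl : forall (r : R) f g h, H f -> H g -> H h ->
    B (r%:C *: f + g) h = r * B f h + B g h;
  sh_ge0 : forall f, H f -> 0 <= B f f;
  sh_rot : forall a f, H f -> B (a *: f) f = re a * B f f;
  sh_normZ : forall a f, H f -> B (a *: f) (a *: f) = normc a ^+ 2 * B f f;
  sh_complete : forall u, (forall n, H (u n)) -> cauchy_for B u ->
    exists2 g, H g & converges_for B u g }.

Variables (H : set V) (B : V -> V -> R).
Hypothesis HB : semi_hilbert H B.

Let Q f : R := B f f.
Let nrm f : R := Num.sqrt (Q f).

Lemma shD f g : H f -> H g -> H (f + g).
Proof. by move=> Hf Hg; have := sh_lin HB 1 Hf Hg; rewrite scale1r. Qed.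

Lemma shZ a f : H f -> H (a *: f).
Proof. by move=> Hf; have := sh_lin HB a Hf (sh_zero HB); rewrite addr0. Qed.

Lemma shB f g : H f -> H g -> H (f - g).
Proof. by move=> Hf Hg; rewrite -scaleN1r; apply: shD => //; exact: shZ. Qed.

Lemma shDl f g h : H f -> H g -> H h -> B (f + g) h = B f h + B g h.
Proof.
by move=> Hf Hg Hh; have := sh_linl HB 1 Hf Hg Hh; rewrite scale1r mul1r.
Qed.

Lemma sh0l h : H h -> B 0 h = 0.
Proof.
move=> Hh; have H0 := sh_zero HB.
by have := shDl H0 H0 Hh; rewrite addr0; lra.
Qed.

Lemma shZl (r : R) f h : H f -> H h -> B (r%:C *: f) h = r * B f h.
Proof.
by move=> Hf Hh; have := sh_linl HB r Hf (sh_zero HB) Hh; rewrite sh0l// !addr0.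
Qed.

Lemma shBl f g h : H f -> H g -> H h -> B (f - g) h = B f h - B g h.
Proof.
move=> Hf Hg Hh; have := sh_linl HB (-1) Hg Hf Hh.
by rewrite rmorphN1 scaleN1r mulN1r addrC => ->; rewrite addrC.
Qed.

Lemma sh_quad (r : R) f g : H f -> H g ->
  Q (r%:C *: f + g) = r ^+ 2 * Q f + 2 * r * B f g + Q g.
Proof.
move=> Hf Hg; have Hs := sh_lin HB r%:C Hf Hg.
rewrite /Q (sh_linl HB)// ![B _ (_ + _)](sh_sym HB)// !(sh_linl HB)//.
rewrite (sh_sym HB Hg Hf).
by ring.
Qed.

Lemma sh_quadB f g : H f -> H g -> Q (f - g) = Q f - 2 * B f g + Q g.
Proof.
move=> Hf Hg; have := sh_quad (-1) Hg Hf.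
rewrite rmorphN1 scaleN1r addrC => ->; rewrite (sh_sym HB Hg Hf).
by rewrite sqrrN expr1n; ring.
Qed.

Lemma sh_quadBC f g : H f -> H g -> Q (f - g) = Q (g - f).
Proof. by move=> Hf Hg; rewrite !sh_quadB// (sh_sym HB Hg Hf); ring. Qed.

Lemma sh_quad_diff f g : H f -> H g ->
  Q f - Q g = Q (f - g) + 2 * B (f - g) g.
Proof. by move=> Hf Hg; rewrite sh_quadB// shBl// /Q; ring. Qed.

Lemma sh_cauchy_schwarz f g : H f -> H g -> B f g ^+ 2 <= Q f * Q g.
Proof.
move=> Hf Hg; apply: discriminant_le; first exact: (sh_ge0 HB).
by move=> r; rewrite -sh_quad//; apply: (sh_ge0 HB); exact: (sh_lin HB).
Qed.

Lemma sh_le_nrm f g : H f -> H g -> `|B f g| <= nrm f * nrm g.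
Proof.
move=> Hf Hg; rewrite -sqrtrM; last exact: (sh_ge0 HB).
by rewrite -sqrtr_sqr; apply: ler_wsqrtr; exact: sh_cauchy_schwarz.
Qed.

Lemma nrm_sqr f : H f -> nrm f ^+ 2 = Q f.
Proof. by move=> Hf; rewrite sqr_sqrtr//; exact: (sh_ge0 HB). Qed.

Lemma nrm_ge0 f : 0 <= nrm f. Proof. exact: sqrtr_ge0. Qed.

Lemma nrm_lt f e : H f -> 0 < e -> (nrm f < e) = (Q f < e ^+ 2).
Proof.
by move=> Hf e0; rewrite -nrm_sqr// ltr_pXn2r ?nnegrE ?nrm_ge0// ltW.
Qed.

Lemma ler_nrmD f g : H f -> H g -> nrm (f + g) <= nrm f + nrm g.
Proof.
move=> Hf Hg; have Hs := shD Hf Hg.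
rewrite -[leRHS]ger0_norm ?addr_ge0 ?nrm_ge0// -sqrtr_sqr; apply: ler_wsqrtr.
rewrite sqrrD !nrm_sqr//.
have := sh_quad 1 Hf Hg; rewrite scale1r expr1n mul1r mulr1 => ->.
have h := le_trans (ler_norm _) (sh_le_nrm Hf Hg).
by rewrite mulr2n; lra.
Qed.

Lemma nrmZ (r : R) f : H f -> nrm (r%:C *: f) = `|r| * nrm f.
Proof.
move=> Hf; rewrite /nrm /Q (sh_normZ HB)// normc_sqr/= expr0n/= addr0.
by rewrite sqrtrM ?sqr_ge0// sqrtr_sqr.
Qed.


Lemma nrmBC f g : H f -> H g -> nrm (f - g) = nrm (g - f).
Proof.
by move=> Hf Hg; rewrite /nrm sh_quadBC.
Qed.

Lemma converges_nrm u g : (forall n, H (u n)) -> H g -> converges_for B u g ->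
  forall e, 0 < e -> exists n, forall i, (n <= i)%N -> nrm (u i - g) < e.
Proof.
move=> Hu Hg ug e e0; have [n nP] := ug (e ^+ 2) (exprn_gt0 _ e0).
by exists n => i ni; rewrite nrm_lt//; [exact: nP|exact: shB].
Qed.

(** The midpoint form is the useful one: the midpoint of two elements of an affine hyperplane lies
    in that hyperplane, so its norm is bounded below by the infimum. *)
Lemma sh_parallelogram f g : H f -> H g ->
  Q (f - g) = 2 * Q f + 2 * Q g - 4 * Q ((2^-1)%:C *: (f + g)).
Proof.
move=> Hf Hg; rewrite sh_quadB//.
have -> : Q ((2^-1)%:C *: (f + g)) = normc (2^-1)%:C ^+ 2 * Q (f + g).
  by apply: (sh_normZ HB); exact: shD.
have := sh_quad 1 Hf Hg; rewrite scale1r expr1n mul1r mulr1 => ->.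
by rewrite normc_sqr/= expr0n/= addr0; field.
Qed.

(** A bounded functional is continuous: the squared modulus of [c - ell g] is at most
    [|C| * Q (u n - g)], which tends to 0. Nothing is known about the sign of [C], hence the
    absolute value. *)
Lemma sh_limit_eq (ell : V -> R[i]) (C : R) (u : nat -> V) g c :
  (forall a f h, ell (a *: f + h) = a * ell f + ell h) ->
  (forall h, H h -> normc (ell h) ^+ 2 <= C * Q h) ->
  (forall n, H (u n)) -> H g -> converges_for B u g ->
  (forall n, ell (u n) = c) -> ell g = c.
Proof.
move=> ellL ellC Hu Hg ug uc; have e1 := ug _ (ltr01 : 0 < 1 :> R).
have C0 : 0 <= `|C| := normr_ge0 C.
apply/eqP; rewrite eq_sym -subr_eq0; apply/eqP; apply: Normc.eq0_normc.
have D n : normc (c - ell g) ^+ 2 <= `|C| * Q (u n - g).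
  have := ellL (-1) g (u n); rewrite uc mulN1r scaleN1r ![- _ + _]addrC => <-.
  apply: le_trans (ellC _ (shB (Hu n) Hg)) _.
  by rewrite ler_wpM2r ?ler_norm//; exact: (sh_ge0 HB (shB (Hu n) Hg)).
apply/eqP; rewrite -sqrf_eq0 eq_le sqr_ge0 andbT; apply: le_eps => e e0.
have C1 : 0 < `|C| + 1 by lra.
have [n nP] := ug (e / (`|C| + 1)) (divr_gt0 e0 C1).
rewrite add0r; apply: le_trans (D n) _; have := nP _ (leqnn n).
rewrite ltr_pdivlMr//; have := sh_ge0 HB (shB (Hu n) Hg); rewrite /Q; nra.
Qed.

(** A minimizing sequence on the hyperplane [ell = 1] is Cauchy by the parallelogram law. Its limit
    stays on the hyperplane because [ell] is bounded, and its norm is the infimum [d]. *)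
Lemma sh_exists_minimal (ell : V -> R[i]) (C : R) :
  (forall a f h, ell (a *: f + h) = a * ell f + ell h) ->
  (forall h, H h -> normc (ell h) ^+ 2 <= C * Q h) ->
  (exists2 f, H f & ell f = 1) ->
  exists phi, [/\ H phi, ell phi = 1 &
    forall g, H g -> ell g = 1 -> nrm phi <= nrm g].
Proof.
move=> ellL ellC [f0 Hf0 f01].
pose S := [set nrm h | h in [set h | H h /\ ell h = 1]].
have S0 : S !=set0 by exists (nrm f0), f0.
have lbS : lbound S 0 by move=> _ [h _ <-]; exact: nrm_ge0.
have hiS : has_inf S by split => //; exists 0.
have [d dE] : exists d : R, d = inf S by exists (inf S).
have d0 : 0 <= d by rewrite dE; exact: lb_le_inf.
have dS g : H g -> ell g = 1 -> d <= nrm g.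
  by move=> Hg g1; rewrite dE; apply: ge_inf => //; [exists 0|exists g].
have /choice[u uP] n : exists h, [/\ H h, ell h = 1 & nrm h < d + n.+1%:R^-1].
  have n0 : 0 < n.+1%:R^-1 :> R by rewrite invr_gt0.
  by have [_ [h [Hh h1] <-] hlt] := inf_adherent n0 hiS; exists h; rewrite dE.
have Hu n : H (u n) by have [] := uP n.
have u1 n : ell (u n) = 1 by have [] := uP n.
have un n : nrm (u n) < d + n.+1%:R^-1 by have [] := uP n.
have [g Hg ug] : exists2 g, H g & converges_for B u g.
  apply: (sh_complete HB) => // e e0.
  (* With x = 1/(n+1) <= 1 the parallelogram law bounds the squared distance by 4 (d + x)^2 - 4 d^2
     = 8 d x + 4 x^2 <= (8 d + 4) x. *)
  have [n] : exists n, 0 + n.+1%:R^-1 < Num.min 1 (e / (8 * d + 5)).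
    by apply: ltr_add_invr; rewrite lt_min ltr01 divr_gt0//; lra.
  rewrite add0r lt_min => /andP[n1]; rewrite ltr_pdivlMr; last by lra.
  have n0 : 0 < n.+1%:R^-1 :> R by rewrite invr_gt0.
  move=> ne; exists n => i j ni nj.
  have unQ k : (n <= k)%N -> Q (u k) <= (d + n.+1%:R^-1) ^+ 2.
    move=> nk; rewrite -(nrm_sqr (Hu k)).
    rewrite ler_pXn2r ?nnegrE ?nrm_ge0//; last by rewrite addr_ge0// ltW.
    apply: ltW; apply: lt_le_trans (un k) _; rewrite lerD2l lef_pV2 ?posrE//.
    by rewrite ler_nat.
  have Hm : H ((2^-1)%:C *: (u i + u j)) by apply: shZ; exact: shD.
  have m1 : ell ((2^-1)%:C *: (u i + u j)) = 1.
    have ellZ a f : ell (a *: f) = a * ell f.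
      have E0 : ell 0 = 0.
        by have := ellL (-1) 0 0; rewrite scaler0 addr0 mulN1r addNr.
      by have := ellL a f 0; rewrite addr0 E0 addr0.
    rewrite ellZ -[u i]scale1r ellL !u1 mulr1 -[1 + 1]/(2 : R[i]).
    by apply/eqP; rewrite eq_complex/=; apply/andP; split; apply/eqP; field.
  have mQ : d ^+ 2 <= Q ((2^-1)%:C *: (u i + u j)).
    by rewrite -nrm_sqr// ler_pXn2r ?nnegrE ?nrm_ge0//; exact: dS.
  rewrite [ltLHS](sh_parallelogram (Hu i) (Hu j)).
  move: (unQ _ ni) (unQ _ nj) mQ n0 n1 ne.
  set x := n.+1%:R^-1 => Qi Qj mQ x0 x1 xe.
  have x2 : x ^+ 2 <= x by rewrite expr2; nra.
  have dx : (d + x) ^+ 2 = d ^+ 2 + 2 * (d * x) + x ^+ 2 by ring.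
  by move: Qi Qj; rewrite dx; lra.
exists g; split => //; first exact: (sh_limit_eq ellL ellC Hu Hg ug u1).
move=> h Hh h1; apply: le_trans (dS _ Hh h1).
apply: le_eps => e e0; have e2 : 0 < e / 2 by lra.
have [n nP] := converges_nrm Hu Hg ug e2.
have [m] : exists m, 0 + m.+1%:R^-1 < e / 2 by exact: ltr_add_invr.
rewrite add0r => me; pose k := maxn n m.
have := nP _ (leq_maxl n m); rewrite -/k (nrmBC (Hu k) Hg) => gk.
have := ler_nrmD (shB Hg (Hu k)) (Hu k); rewrite subrK => /le_trans; apply.
have : k.+1%:R^-1 <= m.+1%:R^-1 :> R.
  by rewrite lef_pV2 ?posrE// ler_nat ltnS leq_maxr.
move: me gk (un k); move: (k.+1%:R^-1) (m.+1%:R^-1) => p q; lra.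
Qed.

(** Adding [r * h] with [ell h = 0] to [phi] preserves the normalisation, so minimality makes
    [r ^+ 2 * Q h + 2 * r * B h phi] nonnegative for all [r], whence [B h phi = 0]. A general [h] is
    [ell h *: phi] plus an element of the kernel of [ell]. *)
Lemma sh_minimal_representer (ell : V -> R[i]) phi :
  (forall a f h, ell (a *: f + h) = a * ell f + ell h) ->
  H phi -> ell phi = 1 ->
  (forall g, H g -> ell g = 1 -> nrm phi <= nrm g) ->
  forall h, H h -> B h phi = re (ell h) * Q phi.
Proof.
move=> ellL Hphi phi1 phimin.
have orth h : H h -> ell h = 0 -> B h phi = 0.
  move=> Hh h0; apply/eqP; rewrite -sqrf_eq0 eq_le sqr_ge0 andbT.
  have := @discriminant_le _ (Q h) (B h phi) 0 (sh_ge0 HB Hh); rewrite mulr0.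
  apply=> r; have := phimin _ (sh_lin HB r%:C Hh Hphi).
  rewrite ellL h0 phi1 mulr0 add0r => /(_ erefl).
  rewrite -(ler_pXn2r (_ : 0 < 2)%N) ?nnegrE ?nrm_ge0//.
  by rewrite !nrm_sqr//; [rewrite sh_quad//; lra|exact: (sh_lin HB)].
move=> h Hh; have Hh' : H (- ell h *: phi + h) by exact: (sh_lin HB).
have /orth : ell (- ell h *: phi + h) = 0 by rewrite ellL phi1 mulr1 addNr.
move=> /(_ Hh'); rewrite shDl//; last exact: shZ.
rewrite (sh_rot HB)//=; have -> : re (- ell h) = - re (ell h) by case: (ell h).
by rewrite -/(Q phi); lra.
Qed.

(** Only the real part of [ell] is represented. Multiplying [h] by the conjugate of [ell h] turns
    the value into the real number [normc (ell h) ^+ 2]; Cauchy-Schwarz then carries this factor on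
    both sides, where it cancels. *)
Lemma sh_representer_le (ell : V -> R[i]) k :
  (forall a f h, ell (a *: f + h) = a * ell f + ell h) ->
  H k -> (forall h, H h -> B h k = re (ell h)) ->
  forall h, H h -> normc (ell h) ^+ 2 <= Q h * Q k.
Proof.
move=> ellL Hk kP h Hh.
have E0 : ell 0 = 0.
  by have := ellL (-1) 0 0; rewrite scaler0 addr0 mulN1r addNr.
have Hc : H ((ell h)^* *: h) by exact: shZ.
have := sh_cauchy_schwarz Hc Hk.
rewrite kP//; have := ellL (ell h)^* h 0; rewrite E0 !addr0 => ->.
have -> : re ((ell h)^* * ell h) = normc (ell h) ^+ 2.
  by rewrite normc_sqr; case: (ell h) => a b /=; ring.
rewrite /Q (sh_normZ HB)//; have -> : normc (ell h)^* = normc (ell h).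
  by case: (ell h) => a b /=; rewrite sqrrN.
have [->|n0] := eqVneq (normc (ell h)) 0.
  by rewrite expr0n/= mulr_ge0//; exact: (sh_ge0 HB).
have n2 : 0 < normc (ell h) ^+ 2 by rewrite lt_def sqrf_eq0 n0 sqr_ge0.
by move=> h2; rewrite -(ler_pM2l n2); move: h2; rewrite /Q; lra.
Qed.

(* Gliding hump: [x] is the sum of the [3^-n]-scaled unit vectors along [v n],
   with signs chosen so that the n-th term does not decrease [`|B x (v n)|]. *)
Lemma sh_gliding_hump (v : nat -> V) : (forall n, H (v n)) ->
  (forall n, n.+1%:R * 3 ^+ n <= nrm (v n)) ->
  exists2 x, H x & forall n, n.+1%:R <= 2 * `|B x (v n)|.
Proof.
move=> Hv vn.
have t0 n : 0 < 3 ^+ n :> R by rewrite exprn_gt0.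
have v0 n : 0 < nrm (v n).
  by apply: lt_le_trans (vn n); rewrite mulr_gt0// ltr0n.
pose s x n : R := (if 0 <= B x (v n) then 1 else -1) / 3 ^+ n / nrm (v n).
have sE x n : `|s x n| = (3 ^+ n)^-1 / nrm (v n).
  rewrite /s !normrM !normfV (gtr0_norm (v0 n)) (gtr0_norm (t0 n)).
  by case: ifP; rewrite ?normrN normr1 mul1r.
pose fix x n := if n is m.+1 then (s (x m) m)%:C *: v m + x m else 0.
have xS n : x n.+1 = (s (x n) n)%:C *: v n + x n by [].
have Hx n : H (x n).
  by elim: n => [|n IH]; [exact: (sh_zero HB)|rewrite xS; exact: (sh_lin HB)].
(* The right-hand side is the geometric sum of 3^-j for n <= j < n + k. *)
have dist n k : nrm (x (n + k)%N - x n) <=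
    (3 / 2) * ((3 ^+ n)^-1 - (3 ^+ (n + k))^-1).
  elim: k => [|k IH].
    by rewrite addn0 !subrr mulr0 /nrm /Q sh0l ?sqrtr0//; exact: (sh_zero HB).
  rewrite addnS xS -addrA.
  apply: le_trans (ler_nrmD (shZ _ (Hv _)) (shB (Hx _) (Hx _))) _.
  rewrite nrmZ// sE divfK ?gt_eqF//.
  apply: le_trans (lerD (lexx _) IH) _.
  rewrite exprS invfM; lra.
have dist' n m : (n <= m)%N -> nrm (x m - x n) <= (3 / 2) * (3 ^+ n)^-1.
  move=> nm; have := dist n (m - n)%N; rewrite subnKC// => /le_trans; apply.
  have : 0 < (3 ^+ m)^-1 :> R by rewrite invr_gt0.
  by lra.
have three n : n.+1%:R <= 3 ^+ n :> R.
  elim: n => [|n IH]; first by rewrite expr0.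
  have : 1 <= n.+1%:R :> R by rewrite ler1n.
  move: IH; rewrite exprS -[n.+2]add1n natrD.
  by move: (n.+1%:R) (3 ^+ n) => a b; lra.
have [g Hg xg] : exists2 g, H g & converges_for B x g.
  apply: (sh_complete HB) => // e e0.
  pose e' := Num.sqrt e; have e'0 : 0 < e' by rewrite sqrtr_gt0.
  (* Both [x i] and [x j] are within (3/2) 3^-n of [x n], and 3^-n <= 1/(n+1). *)
  have [n] : exists n, 0 + n.+1%:R^-1 < e' / 3 by apply: ltr_add_invr; lra.
  rewrite add0r => ne; exists n => i j ni nj.
  have -> : e = e' ^+ 2 by rewrite sqr_sqrtr// ltW.
  rewrite -/(Q _) -nrm_lt//; last exact: shB.
  have -> : x i - x j = (x i - x n) + (x n - x j) by rewrite addrA subrK.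
  apply: le_lt_trans (ler_nrmD (shB (Hx _) (Hx _)) (shB (Hx _) (Hx _))) _.
  rewrite (nrmBC (Hx n) (Hx j)).
  have := dist' _ _ ni; have := dist' _ _ nj.
  have : (3 ^+ n)^-1 <= n.+1%:R^-1 :> R by rewrite lef_pV2 ?posrE.
  by move: ne; move: (n.+1%:R^-1) ((3 ^+ n)^-1) => p t; lra.
exists g => // n.
(* The tail after the n-th term is at most (3/2) 3^-(n+1), half the size of that term; ratio 3 is
   what leaves half of the hump intact. *)
have gn : nrm (g - x n.+1) <= 2^-1 * (3 ^+ n)^-1.
  apply: le_eps => e e0; have [m mP] := converges_nrm Hx Hg xg e0.
  pose k := maxn m n.+1.
  have -> : g - x n.+1 = (g - x k) + (x k - x n.+1) by rewrite addrA subrK.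
  apply: le_trans (ler_nrmD (shB Hg (Hx _)) (shB (Hx _) (Hx _))) _.
  rewrite (nrmBC Hg (Hx k)); have := mP k (leq_maxl _ _).
  have := dist' n.+1 k (leq_maxr _ _); rewrite exprS invfM.
  by lra.
have hump : (3 ^+ n)^-1 * nrm (v n) <= `|B (x n.+1) (v n)|.
  rewrite xS (sh_linl HB)// -/(Q (v n)) -nrm_sqr// /s.
  have -> (a : R) : a / 3 ^+ n / nrm (v n) * nrm (v n) ^+ 2 =
      a * ((3 ^+ n)^-1 * nrm (v n)).
    by field; rewrite !gt_eqF.
  have : 0 < (3 ^+ n)^-1 * nrm (v n) by rewrite mulr_gt0// invr_gt0.
  (* The sign in [s] agrees with that of [B (x n) (v n)], so the two contributions add up without
     cancellation. *)
  case: ifPn => [b0 y0|]; first by rewrite ger0_norm; lra.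
  by rewrite -ltNge => b0 y0; rewrite ltr0_norm; lra.
have diff : `|B (g - x n.+1) (v n)| <= 2^-1 * (3 ^+ n)^-1 * nrm (v n).
  apply: le_trans (sh_le_nrm (shB Hg (Hx _)) (Hv n)) _.
  by rewrite ler_pM2r.
rewrite shBl// in diff.
have vn' : n.+1%:R <= (3 ^+ n)^-1 * nrm (v n).
  by rewrite mulrC ler_pdivlMr.
have := ler_normB (B g (v n)) (B g (v n) - B (x n.+1) (v n)).
rewrite opprB addrCA subrr addr0.
by move: diff; rewrite -mulrA; lra.
Qed.

End semi_hilbert.

Lemma normcM_sqr (R : rcfType) (a b : R[i]) :
  normc (a * b) ^+ 2 = normc a ^+ 2 * normc b ^+ 2.
Proof. by rewrite !normc_sqr; case: a => a1 a2; case: b => b1 b2 /=; ring. Qed.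

Lemma normc_ge_re (R : rcfType) (a : R[i]) : `|re a| <= normc a.
Proof.
rewrite -(ler_pXn2r (_ : 0 < 2)%N) ?nnegrE ?normc_ge0//.
by rewrite real_normK ?num_real// normc_sqr lerDl sqr_ge0.
Qed.

Lemma normc_ge_im (R : rcfType) (a : R[i]) : `|im a| <= normc a.
Proof.
rewrite -(ler_pXn2r (_ : 0 < 2)%N) ?nnegrE ?normc_ge0//.
by rewrite real_normK ?num_real// normc_sqr lerDr sqr_ge0.
Qed.

(** * Weighted square-integrable functions *)

Section weighted_L2.
Context d (T : measurableType d) (R : realType).
Variable m : {measure set T -> \bar R}.

(** Fatou's lemma for a limit known only almost everywhere: [G] is first compared a.e. with the
    lower limit of [F], whose integral is bounded by the lower limit of the integrals. *)
Lemma fatou_le (D : set T) (F : nat -> T -> R) (G : T -> R) (c : R) :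
  measurable D -> (forall n, measurable_fun D (F n)) -> measurable_fun D G ->
  (forall n z, D z -> 0 <= F n z) -> (forall z, D z -> 0 <= G z) ->
  {ae m, forall z, D z -> F n z @[n --> \oo] --> G z} ->
  (forall n, (\int[m]_(z in D) (F n z)%:E <= c%:E)%E) ->
  (\int[m]_(z in D) (G z)%:E <= c%:E)%E.
Proof.
move=> mD mF mG F0 G0 FG Fc.
pose f n z := (F n z)%:E.
have mf n : measurable_fun D (f n) by apply/measurable_EFinP; exact: mF.
have f0 n z : D z -> (0 <= f n z)%E by move=> Dz; rewrite lee_fin F0.
have e0 n z : D z -> (0 <= einfs (f ^~ z) n)%E.
  by move=> Dz; apply: le_ereal_inf_tmp => _ [k /= nk <-]; exact: f0.
apply: (@le_trans _ _ (\int[m]_(z in D) limn_einf (f ^~ z))%E).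
  apply: ae_ge0_le_integral => //.
  - exact/measurable_EFinP.
  - move=> z Dz; rewrite limn_einf_lim; apply: lime_ge; first exact: is_cvg_einfs.
    by apply: nearW => n; exact: e0.
  - apply: (emeasurable_fun_cvg (fun n z => einfs (f ^~ z) n)).
      by move=> n; exact: measurable_fun_einfs.
    by move=> z Dz; rewrite limn_einf_lim; exact: is_cvg_einfs.
  - move: FG; apply: filterS => z Fz Dz.
    have /cvg_limn_einf_sup[-> _] // : f n z @[n --> \oo] --> (G z)%:E.
    by apply/fine_cvgP; split; [exact: nearW|exact: Fz].
apply: le_trans (fatou m mD mf f0) _.
rewrite limn_einf_lim; apply: lime_le; first exact: is_cvg_einfs.
apply: nearW => n; apply: le_trans (Fc n).
by apply: ereal_inf_lbound; exists n => /=.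
Qed.

Implicit Types (D : set T) (w : T -> R) (f g h : T -> R[i]^o).

(** Unfolds to the same expression as [L2] when [m] is Lebesgue measure, so the results below
    specialise by conversion. *)
Definition square_integrable D w f :=
  [/\ measurable_fun D (fun z => re (f z)),
      measurable_fun D (fun z => im (f z)) &
      (\int[m]_(z in D) (normc (f z) ^+ 2 * w z)%:E < +oo)%E].

Definition wip D w f g : R :=
  \int[m]_(z in D) ((re (f z) * re (g z) + im (f z) * im (g z)) * w z).

Definition weight_on D w :=
  measurable_fun D w /\ forall z, D z -> 0 < w z.

Section fixed_weight.
Variables (D : set T) (w : T -> R).
Hypotheses (mD : measurable D) (Dw : weight_on D w).

Let w0 z : D z -> 0 <= w z.
Proof. by move=> Dz; apply: ltW; case: Dw => _; exact. Qed.

Lemma measurable_wip f g :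
  measurable_fun D (fun z => re (f z)) -> measurable_fun D (fun z => im (f z)) ->
  measurable_fun D (fun z => re (g z)) -> measurable_fun D (fun z => im (g z)) ->
  measurable_fun D (fun z => (re (f z) * re (g z) + im (f z) * im (g z)) * w z).
Proof.
move=> rf jf rg ig; apply: measurable_funM; last by case: Dw.
by apply: measurable_funD; exact: measurable_funM.
Qed.

Lemma measurable_normc2 f :
  measurable_fun D (fun z => re (f z)) -> measurable_fun D (fun z => im (f z)) ->
  measurable_fun D (fun z => normc (f z) ^+ 2 * w z).
Proof.
move=> rf jf; rewrite (_ : (fun z => _) = (fun z =>
  (re (f z) * re (f z) + im (f z) * im (f z)) * w z)); first exact: measurable_wip.
by apply/funext => z; rewrite normc_sqr !expr2.
Qed.

Lemma square_integrable_normc2 f : square_integrable D w f ->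
  m.-integrable D (EFin \o (fun z => normc (f z) ^+ 2 * w z)).
Proof.
move=> [rf jf fi]; apply/integrableP; split.
  by apply/measurable_EFinP; exact: measurable_normc2.
under eq_integral => z /set_mem Dz.
  rewrite /= ger0_norm; last by rewrite mulr_ge0 ?sqr_ge0 ?w0.
  over.
exact: fi.
Qed.

(** Since [|a * b| <= a ^+ 2 + b ^+ 2], the integrand is dominated by the sum of the two weighted
    squares. *)
Lemma integrable_wip f g : square_integrable D w f -> square_integrable D w g ->
  m.-integrable D
    (EFin \o (fun z => (re (f z) * re (g z) + im (f z) * im (g z)) * w z)).
Proof.
move=> f2 g2; have := integrableD mD (square_integrable_normc2 f2)
  (square_integrable_normc2 g2).
apply: le_integrable => //.
  by case: f2 => ? ? _; case: g2 => ? ? _; apply/measurable_EFinP;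
    exact: measurable_wip.
move=> z Dz /=; rewrite lee_fin -mulrDl !normrM; apply: ler_wpM2r => //.
rewrite [leRHS]ger0_norm ?addr_ge0 ?sqr_ge0// !normc_sqr ler_norml.
set a := re (f z); set b := re (g z); set c := im (f z); set e := im (g z).
have := sqr_ge0 (a + b); have := sqr_ge0 (a - b).
have := sqr_ge0 (c + e); have := sqr_ge0 (c - e).
have := sqr_ge0 a; have := sqr_ge0 b; have := sqr_ge0 c; have := sqr_ge0 e.
by move=> *; apply/andP; split; lra.
Qed.

Lemma square_integrable0 : square_integrable D w (fun=> 0).
Proof.
split; [exact: measurable_cst|exact: measurable_cst|].
by under eq_integral do rewrite normc_sqr/= expr0n/= addr0 mul0r; rewrite integral0.
Qed.

Lemma square_integrable_lin a f g :
  square_integrable D w f -> square_integrable D w g ->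
  square_integrable D w (fun z => a * f z + g z).
Proof.
move=> f2 g2; have [[rf jf _] [rg ig _]] := (f2, g2).
have Er : (fun z => re (a * f z + g z)) =
    (fun z => (re a * re (f z) - im a * im (f z)) + re (g z)).
  by apply/funext => z; case: (a) (f z) (g z) => [? ?] [? ?] [? ?].
have Ei : (fun z => im (a * f z + g z)) =
    (fun z => (re a * im (f z) + im a * re (f z)) + im (g z)).
  by apply/funext => z; case: (a) (f z) (g z) => [? ?] [? ?] [? ?].
have mr : measurable_fun D (fun z => re (a * f z + g z)).
  rewrite Er; apply: measurable_funD => //; apply: measurable_funB;
    exact: measurable_funM.
have mi : measurable_fun D (fun z => im (a * f z + g z)).
  rewrite Ei; apply: measurable_funD => //; apply: measurable_funD;
    exact: measurable_funM.
split => //.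
have I := integrableD mD
  (integrableZl mD (2 * normc a ^+ 2) (square_integrable_normc2 f2))
  (integrableZl mD 2 (square_integrable_normc2 g2)).
have : m.-integrable D (EFin \o (fun z => normc (a * f z + g z) ^+ 2 * w z)).
  apply: le_integrable I => //.
    by apply/measurable_EFinP; exact: measurable_normc2.
  move=> z Dz /=; rewrite lee_fin.
  have wz := w0 Dz; have nf := sqr_ge0 (normc (f z)).
  have ng := sqr_ge0 (normc (g z)); have na := sqr_ge0 (normc a).
  rewrite [leLHS]ger0_norm; last by rewrite mulr_ge0 ?sqr_ge0.
  rewrite [leRHS]ger0_norm; last by apply: addr_ge0; repeat apply: mulr_ge0 => //.
  rewrite [leRHS](_ : _ = (2 * normc (a * f z) ^+ 2 + 2 * normc (g z) ^+ 2) * w z).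
    apply: ler_wpM2r => //; rewrite !normc_sqr.
    move: (a * f z) (g z) => [p q] [r s] /=.
    by have := sqr_ge0 (p - r); have := sqr_ge0 (q - s); lra.
  by rewrite normcM_sqr; ring.
move/integrableP => [_]; under eq_integral => z /set_mem Dz.
  rewrite /= ger0_norm; last by rewrite mulr_ge0 ?sqr_ge0 ?w0.
  over.
by [].
Qed.

Lemma wipC f g : wip D w f g = wip D w g f.
Proof.
by apply: eq_Rintegral => z _; congr (_ * w z); rewrite mulrC; congr +%R; rewrite mulrC.
Qed.

Lemma wip_linl (r : R) f g h : square_integrable D w f ->
  square_integrable D w g -> square_integrable D w h ->
  wip D w (fun z => r%:C * f z + g z) h = r * wip D w f h + wip D w g h.
Proof.
move=> f2 g2 h2; have If := integrable_wip f2 h2; have Ig := integrable_wip g2 h2.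
rewrite /wip -RintegralZl// -RintegralD//; last exact: (integrableZl mD r If).
apply: eq_Rintegral => z _; case: (f z) (g z) (h z) => [a b] [a' b'] [p q] /=.
by ring.
Qed.

Lemma wip_normc2 f :
  wip D w f f = \int[m]_(z in D) (normc (f z) ^+ 2 * w z).
Proof. by apply: eq_Rintegral => z _; rewrite normc_sqr !expr2. Qed.

Lemma wip_ge0 f : 0 <= wip D w f f.
Proof.
by rewrite wip_normc2; apply: Rintegral_ge0 => z Dz; rewrite mulr_ge0 ?sqr_ge0 ?w0.
Qed.

Lemma wip_rot a f : square_integrable D w f ->
  wip D w (fun z => a * f z) f = re a * wip D w f f.
Proof.
move=> f2; have If := integrable_wip f2 f2.
rewrite /wip -RintegralZl//; apply: eq_Rintegral => z _.
by case: (a) (f z) => [b c] [p q] /=; ring.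
Qed.

Lemma wip_normZ a f : square_integrable D w f ->
  wip D w (fun z => a * f z) (fun z => a * f z) = normc a ^+ 2 * wip D w f f.
Proof.
move=> f2; have If := integrable_wip f2 f2.
rewrite normc_sqr /wip -RintegralZl//; apply: eq_Rintegral => z _.
by case: (a) (f z) => [b c] [p q] /=; ring.
Qed.

Lemma wip_EFin f : square_integrable D w f ->
  (\int[m]_(z in D) (normc (f z) ^+ 2 * w z)%:E = (wip D w f f)%:E)%E.
Proof.
move=> f2; rewrite wip_normc2 /Rintegral fineK//.
exact: (integrable_fin_num mD (square_integrable_normc2 f2)).
Qed.

End fixed_weight.

Lemma square_integrableS D E w v f : measurable D -> measurable E ->
  weight_on D w -> weight_on E v -> E `<=` D -> (forall z, E z -> v z <= w z) ->
  square_integrable D w f -> square_integrable E v f /\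
    wip E v f f <= wip D w f f.
Proof.
move=> mD mE Dw Ev ED vw f2; have [rf jf fi] := f2.
have rE : measurable_fun E (fun z => re (f z)) by apply: measurable_funS rf.
have iE : measurable_fun E (fun z => im (f z)) by apply: measurable_funS jf.
have le : (\int[m]_(z in E) (normc (f z) ^+ 2 * v z)%:E <=
           \int[m]_(z in D) (normc (f z) ^+ 2 * w z)%:E)%E.
  apply: (@le_trans _ _ (\int[m]_(z in E) (normc (f z) ^+ 2 * w z)%:E)%E).
    have mw : weight_on E w.
      split; first by apply: measurable_funS Dw.1.
      by move=> z /ED; exact: Dw.2.
    apply: ge0_le_integral => //.
    - by move=> z Ez; rewrite lee_fin mulr_ge0 ?sqr_ge0// ltW// Ev.2.
    - by apply/measurable_EFinP; exact: measurable_normc2.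
    - by apply/measurable_EFinP; exact: measurable_normc2.
    - by move=> z Ez; rewrite lee_fin ler_wpM2l ?sqr_ge0 ?vw.
  apply: ge0_subset_integral => //.
    by apply/measurable_EFinP; exact: measurable_normc2.
  by move=> z Dz; rewrite lee_fin mulr_ge0 ?sqr_ge0// ltW// Dw.2.
have f2E : square_integrable E v f by split => //; exact: le_lt_trans fi.
by split => //; rewrite -lee_fin -!wip_EFin.
Qed.

End weighted_L2.

Lemma real_cauchy_cvg (R : realType) (a : nat -> R) :
  (forall e, 0 < e -> exists n, forall i j, (n <= i)%N -> (n <= j)%N ->
    `|a i - a j| < e) -> exists l : R, a n @[n --> \oo] --> l.
Proof.
move=> Ha; have : cvg (a n @[n --> \oo]).
  apply: cauchy_cvg; apply: cauchy_exP => e e0; have [n nP] := Ha e e0.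
  exists (a n); exists n => // i ni; exact: nP.
by move/cvg_ex.
Qed.

(* The abstract form of a weight being admissible: [Hol] plays the role of the
   holomorphic functions on [D]. *)
Section complete_space.
Context d (T : measurableType d) (R : realType).
Variables (m : {measure set T -> \bar R}) (D : set T) (w : T -> R).
Hypotheses (mD : measurable D) (Dw : weight_on D w).
Variable Hol : set (T -> R[i]^o).
Hypothesis Hol0 : Hol (fun=> 0).
Hypothesis Hol_lin : forall (a : R[i]) f g, Hol f -> Hol g ->
  Hol (fun z => a * f z + g z).

Definition L2_subspace : set (T -> R[i]^o) :=
  [set f | Hol f /\ square_integrable m D w f].

Let nrm (f : T -> R[i]^o) : R :=
  Num.sqrt (\int[m]_(z in D) (normc (f z) ^+ 2 * w z)).

Hypothesis Hol_closed : forall f, square_integrable m D w f ->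
  (forall e : R, 0 < e -> exists2 h, L2_subspace h & nrm (fun z => h z - f z) < e) ->
  exists2 g, L2_subspace g & {ae m, forall z, D z -> g z = f z}.

Hypothesis eval_continuous : forall z, D z -> forall f, L2_subspace f ->
  forall e : R, 0 < e -> exists2 dl : R, 0 < dl &
    forall g, L2_subspace g -> nrm (fun x => g x - f x) < dl ->
      normc (g z - f z) < e.

Lemma L2_subspace_lin a f g : L2_subspace f -> L2_subspace g ->
  L2_subspace (fun z => a * f z + g z).
Proof.
by move=> [f1 f2] [g1 g2]; split; [exact: Hol_lin|exact: square_integrable_lin].
Qed.

Lemma L2_subspace0 : L2_subspace (fun=> 0).
Proof. by split => //; exact: square_integrable0. Qed.

Lemma square_integrableB f g : square_integrable m D w f ->
  square_integrable m D w g -> square_integrable m D w (fun z => f z - g z).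
Proof.
move=> f2 g2; have := square_integrable_lin mD Dw (-1) g2 f2.
rewrite (_ : (fun z => -1 * g z + f z) = (fun z => f z - g z))//.
by apply/funext => z; rewrite mulN1r addrC.
Qed.

(** Continuity at the zero function with tolerance 1 gives a radius [dl]; rescaling [h] into that
    ball yields the bound [2 / dl] for the functional, and [C] is its square. *)
Lemma eval_bounded z : D z -> exists C : R, forall h, L2_subspace h ->
  normc (h z) ^+ 2 <= C * wip m D w h h.
Proof.
move=> Dz; have [dl dl0 dlP] := eval_continuous Dz L2_subspace0 (ltr01 : 0 < 1 :> R).
exists (4 / dl ^+ 2) => h Hh; have [h1 h2] := Hh.
pose q := Num.sqrt (wip m D w h h); have q0 : 0 <= q by exact: sqrtr_ge0.
have q2 : q ^+ 2 = wip m D w h h by rewrite sqr_sqrtr// wip_ge0.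
suff le : normc (h z) <= 2 * q / dl.
  rewrite -q2 (_ : _ * _ = (2 * q / dl) ^+ 2); last by field; rewrite gt_eqF.
  rewrite ler_pXn2r ?nnegrE ?normc_ge0//; apply: divr_ge0; last exact: ltW.
  by rewrite mulr_ge0.
(* The term [e * dl] keeps the denominator positive when [q = 0], and [s * q < dl] still holds. *)
apply: le_eps => e e0; pose s := dl / (2 * q + e * dl).
have den0 : 0 < 2 * q + e * dl by have := mulr_gt0 e0 dl0; lra.
have s0 : 0 < s by rewrite divr_gt0.
have Hg : L2_subspace (fun z => s%:C * h z).
  have := L2_subspace_lin s%:C Hh L2_subspace0.
  rewrite (_ : (fun z => _ + 0) = (fun z => s%:C * h z))//.
  by apply/funext => x; rewrite addr0.
have := dlP _ Hg.
have -> : nrm (fun x => s%:C * h x - 0) = s * q.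
  rewrite /nrm; under eq_Rintegral do rewrite subr0.
  rewrite -wip_normc2 wip_normZ// normc_sqr/= expr0n/= addr0.
  by rewrite sqrtrM ?sqr_ge0// sqrtr_sqr gtr0_norm.
have -> : s * q < dl.
  rewrite /s mulrAC ltr_pdivrMr// ltr_pM2l//.
  by have := mulr_gt0 e0 dl0; lra.
move=> /(_ isT); rewrite subr0.
have -> : normc (s%:C * h z) = s * normc (h z).
  by rewrite Normc.normcM/= expr0n/= addr0 sqrtr_sqr gtr0_norm.
rewrite /s mulrAC ltr_pdivrMr// mul1r => le; apply: ltW.
have -> : 2 * q / dl + e = (2 * q + e * dl) / dl by field; rewrite gt_eqF.
by rewrite ltr_pdivlMr// mulrC.
Qed.

Lemma wip_ae_normc f g : square_integrable m D w f -> square_integrable m D w g ->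
  {ae m, forall z, D z -> g z = f z} -> wip m D w f f = wip m D w g g.
Proof.
move=> f2 g2 fg; rewrite !wip_normc2; congr fine.
have [rf jf _] := f2; have [rg jg _] := g2.
apply: ae_eq_integral => //; try by apply/measurable_EFinP; exact: measurable_normc2.
by move: fg; apply: filterS => z fgz Dz; rewrite fgz.
Qed.

(** Bounded evaluations make a Cauchy sequence converge at every point of [D], so no subsequence has
    to be extracted. Fatou shows that the pointwise limit [F] is also the limit in norm, and
    closedness replaces [F] by an a.e. equal element of the subspace. *)
Lemma L2_subspace_complete (u : nat -> T -> R[i]^o) :
  (forall n, L2_subspace (u n)) -> cauchy_for (wip m D w) u ->
  exists2 g, L2_subspace g & converges_for (wip m D w) u g.
Proof.
move=> Hu cu.
have u2 n : square_integrable m D w (u n) by case: (Hu n).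
have HB i j : L2_subspace (fun x => u i x - u j x).
  have := L2_subspace_lin (-1) (Hu j) (Hu i).
  by rewrite (_ : (fun z => _ + _) = (fun x => u i x - u j x))//;
    apply/funext => x; rewrite mulN1r addrC.
have ptc z : D z -> forall e : R, 0 < e -> exists n, forall i j,
    (n <= i)%N -> (n <= j)%N -> normc (u i z - u j z) < e.
  move=> Dz e e0; have [C CP] := eval_bounded Dz.
  have C1 : 0 < `|C| + 1 by have := normr_ge0 C; lra.
  have [n nP] := cu (e ^+ 2 / (`|C| + 1)) (divr_gt0 (exprn_gt0 _ e0) C1).
  exists n => i j ni nj; have := nP i j ni nj; rewrite ltr_pdivlMr// => lt.
  rewrite -(ltr_pXn2r (_ : 0 < 2)%N) ?nnegrE ?normc_ge0 ?ltW//.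
  apply: le_lt_trans (CP _ (HB i j)) _; apply: le_lt_trans lt.
  rewrite -[u i - u j]/(fun x => u i x - u j x) mulrC.
  apply: ler_wpM2l; first exact: wip_ge0.
  by have := ler_norm C; lra.
have cvr z : D z -> exists l : R, re (u n z) @[n --> \oo] --> l.
  move=> Dz; apply: real_cauchy_cvg => e e0; have [n nP] := ptc z Dz e e0.
  exists n => i j ni nj; apply: le_lt_trans (nP _ _ ni nj).
  by apply: le_trans (normc_ge_re _); case: (u i z) (u j z) => [? ?] [? ?].
have cvi z : D z -> exists l : R, im (u n z) @[n --> \oo] --> l.
  move=> Dz; apply: real_cauchy_cvg => e e0; have [n nP] := ptc z Dz e e0.
  exists n => i j ni nj; apply: le_lt_trans (nP _ _ ni nj).
  rewrite -(ler_pXn2r (_ : 0 < 2)%N) ?nnegrE ?normc_ge0//.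
  rewrite real_normK ?num_real// normc_sqr.
  by case: (u i z) (u j z) => [? ?] [? ?] /=; rewrite lerDr sqr_ge0.
pose F z : R[i]^o := lim (re (u n z) @[n --> \oo]) +i* lim (im (u n z) @[n --> \oo]).
have Fr z : D z -> re (u n z) @[n --> \oo] --> re (F z).
  by move=> Dz; have [l ul] := cvr z Dz; rewrite /= (cvg_lim _ ul).
have Fi z : D z -> im (u n z) @[n --> \oo] --> im (F z).
  by move=> Dz; have [l ul] := cvi z Dz; rewrite /= (cvg_lim _ ul).
have mFr : measurable_fun D (fun z => re (F z)).
  apply: (measurable_fun_cvg (h := fun n z => re (u n z))); last exact: Fr.
  by move=> n; case: (u2 n).
have mFi : measurable_fun D (fun z => im (F z)).
  apply: (measurable_fun_cvg (h := fun n z => im (u n z))); last exact: Fi.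
  by move=> n; case: (u2 n).
have ReB (a b : R[i]) : re (a - b) = re a - re b by case: a b => [? ?] [? ?].
have ImB (a b : R[i]) : im (a - b) = im a - im b by case: a b => [? ?] [? ?].
have tail e : 0 < e -> exists n, forall i, (n <= i)%N ->
    square_integrable m D w (fun z => u i z - F z) /\
    wip m D w (fun z => u i z - F z) (fun z => u i z - F z) <= e.
  move=> e0; have [n nP] := cu e e0; exists n => i ni.
  have mr : measurable_fun D (fun z => re (u i z - F z)).
    rewrite (_ : (fun z => _) = (fun z => re (u i z) - re (F z))).
      by apply: measurable_funB => //; case: (u2 i).
    by apply/funext => z; rewrite ReB.
  have mi : measurable_fun D (fun z => im (u i z - F z)).
    rewrite (_ : (fun z => _) = (fun z => im (u i z) - im (F z))).
      by apply: measurable_funB => //; case: (u2 i).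
    by apply/funext => z; rewrite ImB.
  (* Fatou with [i] fixed and the second index [n + j] going to infinity; the shift by [n] places
     every integral in the Cauchy range. *)
  have le : (\int[m]_(z in D) (normc (u i z - F z) ^+ 2 * w z)%:E <= e%:E)%E.
    apply: (@fatou_le _ _ _ _ _
      (fun j z => normc (u i z - u (n + j)%N z) ^+ 2 * w z)) => //.
    - move=> j; have [? ? _] := square_integrableB (u2 i) (u2 (n + j)%N).
      exact: (measurable_normc2 Dw (f := fun z => u i z - u (n + j)%N z)).
    - exact: (measurable_normc2 Dw (f := fun z => u i z - F z)).
    - by move=> j z Dz; rewrite mulr_ge0 ?sqr_ge0// ltW// Dw.2.
    - by move=> z Dz; rewrite mulr_ge0 ?sqr_ge0// ltW// Dw.2.
    - apply: aeW => z Dz; apply: cvgMl; rewrite normc_sqr ReB ImB.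
      under eq_fun do rewrite normc_sqr ReB ImB.
      have shift (a : nat -> R) (l : R) : a k @[k --> \oo] --> l ->
          a (n + k)%N @[k --> \oo] --> l.
        by move=> al; rewrite -(cvg_shiftn n) in al; under eq_fun do rewrite addnC.
      have sq (a : nat -> R) (l : R) : a k @[k --> \oo] --> l ->
          a k ^+ 2 @[k --> \oo] --> l ^+ 2.
        by move=> al; rewrite expr2; under eq_fun do rewrite expr2; exact: cvgM.
      have cr := cvgB (cvg_cst (re (u i z))) (shift _ _ (Fr z Dz)).
      have ci := cvgB (cvg_cst (im (u i z))) (shift _ _ (Fi z Dz)).
      exact: (cvgD (sq _ _ (cr _ _)) (sq _ _ (ci _ _))).
    - move=> j; have f2 := square_integrableB (u2 i) (u2 (n + j)%N).
      rewrite (wip_EFin mD Dw f2) lee_fin; apply: ltW; apply: nP => //.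
      exact: leq_addr.
  have f2 : square_integrable m D w (fun z => u i z - F z).
    by split => //; apply: le_lt_trans le _; rewrite ltry.
  by split => //; rewrite -lee_fin -wip_EFin.
have F2 : square_integrable m D w F.
  have [n nP] := tail 1 ltr01; have [f2 _] := nP n (leqnn n).
  have := square_integrableB (u2 n) f2.
  rewrite (_ : (fun z => _) = F)//.
  by apply/funext => z; rewrite opprB addrCA subrr addr0.
have [g Hg gF] : exists2 g, L2_subspace g & {ae m, forall z, D z -> g z = F z}.
  apply: Hol_closed => // e e0.
  have e2 : 0 < (e / 2) ^+ 2 by apply: exprn_gt0; lra.
  have [n nP] := tail _ e2; have [f2 le] := nP n (leqnn n).
  exists (u n) => //; apply: (@le_lt_trans _ _ (e / 2)); last by lra.
  rewrite /nrm -wip_normc2.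
  rewrite -[leRHS]ger0_norm; last by lra.
  by rewrite -sqrtr_sqr; exact: ler_wsqrtr.
exists g => // e e0; have e2 : 0 < e / 2 by lra.
have [n nP] := tail _ e2; exists n => i ni; have [f2 le] := nP i ni.
have g2 : square_integrable m D w g by case: Hg.
rewrite -[u i - g]/(fun z => u i z - g z) -(@wip_ae_normc (fun z => u i z - F z)) //.
- by lra.
- exact: square_integrableB.
- by move: gF; apply: filterS => z gz Dz; rewrite gz.
Qed.

Lemma L2_subspace_semi_hilbert : semi_hilbert L2_subspace (wip m D w).
Proof.
split.
- exact: L2_subspace_lin.
- exact: L2_subspace0.
- by move=> f g _ _; exact: wipC.
- by move=> r f g h [_ ?] [_ ?] [_ ?]; exact: wip_linl.
- by move=> f _; exact: wip_ge0.
- by move=> a f [_ ?]; exact: wip_rot.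
- by move=> a f [_ ?]; exact: wip_normZ.
- exact: L2_subspace_complete.
Qed.

End complete_space.

(** * Topology and measurability in complex space *)

(** The first-order expansion of [f] at [x] is also one of [g], and differentials are unique. This
    serves to glue local holomorphic limits. *)
Lemma near_eq_differentiable (K : numFieldType) (V W : normedModType K)
    (f g : V -> W) (x : V) : (\forall y \near x, f y = g y) ->
  differentiable f x -> differentiable g x.
Proof.
move=> fg df; have fgx := nbhs_singleton fg.
have E : g \o shift x = cst (g x) + 'd f x +o_ 0 id.
  apply/eqaddoP => e e0; have /eqaddoP/(_ e e0) := diff_locally df.
  have : \forall y \near 0, f (y + x) = g (y + x).
    by move: fg; rewrite (near_shift 0 x); apply: filterS => y /=; rewrite subr0.
  by apply: filterS2 => y /= fgy; rewrite !fctE /= fgy fgx.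
apply/diff_locallyP; rewrite (diff_unique (diff_continuous df) E); split => //.
exact: diff_continuous.
Qed.

Section complex_space_topology.
Variables (R : realType) (N : nat).
Local Notation C := (Cn R N).

(** The norm of [Cn] takes values in [R[i]], with zero imaginary part; estimates are carried out in
    [R]. *)
Definition rnorm (v : C) : R := re `|v|.

Lemma rnormE (v : C) : `|v| = (rnorm v)%:C.
Proof. by have /ger0_Im := normr_ge0 v; rewrite /rnorm; case: `|v| => a b /= ->. Qed.

Lemma rnorm_ge0 (v : C) : 0 <= rnorm v.
Proof. by rewrite -lecR -rnormE normr_ge0. Qed.

Lemma rnorm_gt0 (v : C) : v != 0 -> 0 < rnorm v.
Proof. by move=> v0; have := normr_gt0 v; rewrite v0 rnormE ltcE/= eqxx. Qed.

Lemma pos_complexE (e : R[i]) : 0 < e -> e = (re e)%:C /\ 0 < re e.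
Proof.
by case: e => a b; rewrite ltcE/= => /andP[/eqP -> a0]; split.
Qed.

Lemma nbhs_rnormP (t : C) (A : set C) :
  nbhs t A <-> exists2 e : R, 0 < e & forall s, rnorm (s - t) < e -> A s.
Proof.
split=> [/nbhs_ballP[e /pos_complexE[eE e0] eA]|[e e0 eA]].
  exists (re e) => // s st; apply: eA; rewrite eE -ball_normE/= distrC rnormE.
  by rewrite ltcR.
apply/nbhs_ballP; exists e%:C; first by rewrite /= ltcE/= eqxx.
by move=> s; rewrite -ball_normE/= distrC rnormE ltcR => /eA.
Qed.

(** A countable index set: a rational centre in each complex coordinate, and [n] for the radius
    1/(n+1). *)
Let box_index := ({ffun 'I_N -> rat * rat} * nat)%type.

Let in_box (p : R * R) (e : R) (z : R[i]) :=
  `|re z - p.1| < e /\ `|im z - p.2| < e.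

Let box (i : box_index) : set C :=
  [set z | forall j, in_box (ratr (i.1 j).1, ratr (i.1 j).2) i.2.+1%:R^-1 (z 0 j)].

Lemma measurable_box i : measurable (box i).
Proof.
rewrite /measurable/= /lebesgue_measurable.
apply: sub_caratheodory; apply: sub_gen_smallest.
rewrite (_ : _ @^-1` _ = \big[setI/setT]_(j < N)
  ((fun x : (N + N).-tuple (measurableTypeR R) => tnth x (lshift N j)) @^-1`
     ball (ratr (i.1 j).1 : R) i.2.+1%:R^-1 `&`
   (fun x : (N + N).-tuple (measurableTypeR R) => tnth x (rshift N j)) @^-1`
     ball (ratr (i.1 j).2 : R) i.2.+1%:R^-1)).
  apply: bigsetI_measurable => j _; apply: measurableI;
    rewrite -[X in measurable X]setTI; apply: measurable_tnth => //;
    exact: measurable_ball.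
apply/seteqP; split => x.
  rewrite /box/= -bigcap_seq => xb j _; have := xb j; rewrite /in_box mxE/=.
  by rewrite -!ball_normE/= ![`|_ - tnth _ _|]distrC.
rewrite /box/= -bigcap_seq => xb j; have := xb j; rewrite /in_box mxE/=.
rewrite -!ball_normE/= ![`|_ - tnth _ _|]distrC; apply.
exact: mem_index_enum.
Qed.

Lemma normc_le_reim (z : R[i]) : normc z <= `|re z| + `|im z|.
Proof.
have a0 := normr_ge0 (re z); have b0 := normr_ge0 (im z).
rewrite -(ler_pXn2r (_ : 0 < 2)%N) ?nnegrE ?normc_ge0 ?addr_ge0//.
rewrite normc_sqr sqrrD !real_normK ?num_real// lerD2r lerDl.
by rewrite mulrn_wge0// mulr_ge0.
Qed.

(** An open set is the union of the countably many rational boxes that it contains. *)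
Lemma open_measurable_Cn (U : set C) : open U -> measurable U.
Proof.
move=> oU; rewrite (_ : U = \bigcup_(i in [set i | box i `<=` U]) box i).
  rewrite bigcup_mkcond; apply: countable_bigcupT_measurable => [|i].
    exact: countableP.
  by case: ifPn => // _; exact: measurable_box.
apply/seteqP; split; last by move=> z [i iU zi]; exact: iU.
move=> z Uz; have := oU; rewrite openE => /(_ z Uz)/nbhs_ballP[e].
move=> /pos_complexE[eE e0] eU.
(* Two points of a box of radius r differ by less than 2 r in each real and imaginary part, hence by
   less than 4 r in each complex coordinate. *)
have [n] : exists n, 0 + n.+1%:R^-1 < re e / 4.
  by apply: ltr_add_invr; rewrite divr_gt0.
rewrite add0r => ne; set r : R := n.+1%:R^-1 in ne.
have r0 : 0 < r by rewrite invr_gt0.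
have rat_near (x : R) : exists q : rat, `|x - ratr q| < r.
  have [q] := @rat_in_itvoo R (x - r) (x + r) ltac:(lra).
  by rewrite in_itv/= => /andP[q1 q2]; exists q; rewrite ltr_norml; lra.
have /choice[q qP] (j : 'I_N) : exists p : rat * rat,
    in_box (ratr p.1, ratr p.2) r (z 0 j).
  have [p1 h1] := rat_near (re (z 0 j)); have [p2 h2] := rat_near (im (z 0 j)).
  by exists (p1, p2).
exists ([ffun j => q j], n); last first.
  by move=> j /=; rewrite ffunE; exact: qP.
move=> y yb; apply: eU; split; first by rewrite eE ltcE/= eqxx.
move=> i j; rewrite (ord1 i) -ball_normE/= eE normc_def -normc_sqr.
rewrite sqrtr_sqr ger0_norm ?normc_ge0// ltcR.
apply: le_lt_trans (normc_le_reim _) _.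
have [h1 h2] := qP j; have [] := yb j; rewrite /= ffunE -/r.
have -> : re (z 0 j - y 0 j) = re (z 0 j) - re (y 0 j).
  by case: (z 0 j) (y 0 j) => [? ?] [? ?].
have -> : im (z 0 j - y 0 j) = im (z 0 j) - im (y 0 j).
  by case: (z 0 j) (y 0 j) => [? ?] [? ?].
move: h1 h2 => /=; move: (re (z 0 j)) (re (y 0 j)) (im (z 0 j)) (im (y 0 j)).
move=> a b c f; rewrite !ltr_norml => /andP[? ?] /andP[? ?] /andP[? ?] /andP[? ?].
have : `|a - b| < 2 * r by rewrite ltr_norml; lra.
have : `|c - f| < 2 * r by rewrite ltr_norml; lra.
by lra.
Qed.

Lemma normC_normc (z : R[i]) : `|z| = (normc z)%:C.
Proof. by rewrite normc_def -normc_sqr sqrtr_sqr ger0_norm// normc_ge0. Qed.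

(** The differential contributes its Lipschitz constant, and the remainder, taken with tolerance 1,
    contributes 1. *)
Lemma differentiable_lipschitz (f : C -> R[i]^o) (t : C) : differentiable f t ->
  exists K dl : R, 0 < dl /\
    forall s, rnorm (s - t) < dl -> normc (f s - f t) <= K * rnorm (s - t).
Proof.
move=> df; have /eqaddoP/(_ 1 ltr01) := diff_locally df.
have [k /pos_complexE[kE k0] kP] := linear_lipschitz (diff_continuous df).
move=> /nbhs_rnormP[e e0 eP]; exists (re k + 1), e; split => // s st.
have := eP (s - t); rewrite subr0 => /(_ st).
rewrite /= mul1r !fctE/= subrK => le.
rewrite -lecR -normC_normc.
have -> : ((re k + 1) * rnorm (s - t))%:C = k * `|s - t| + `|s - t|.
  by rewrite rnormE [in RHS]kE; apply/eqP; rewrite eq_complex/=;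
    apply/andP; split; apply/eqP; ring.
rewrite -(subrK ('d f t (s - t)) (f s - f t)) addrC.
apply: le_trans (ler_normD _ _) _; apply: lerD => //.
by rewrite -addrA -opprD.
Qed.

End complex_space_topology.

(** * The Bergman kernel *)

Section bergman_space.
Variables (R : realType) (N : nat).
Implicit Types (D E : set (Cn R N)) (mu nu : Cn R N -> R).

Let fct := Cn R N -> R[i]^o.

Definition ip D mu : fct -> fct -> R := wip (@lebesgue_Cn R N) D mu.

Lemma holomorphic_lin D (a : R[i]) (f g : fct) : holomorphic D f ->
  holomorphic D g -> holomorphic D (fun z => a * f z + g z).
Proof.
move=> hf hg z Dz; apply: (differentiableD (f := fun z => a *: f z)).
  by apply: differentiableZ; exact: hf.
exact: hg.
Qed.

Lemma holomorphic0 D : holomorphic D (fun=> 0).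
Proof. by move=> z _; exact: differentiable_cst. Qed.

Section fixed_domain.
Variables (D : set (Cn R N)) (mu : Cn R N -> R).
Hypotheses (oD : open D) (aw : admissible D mu).

Let H : set fct := L2H D mu.
Let B := ip D mu.

Let mD : measurable D. Proof. exact: open_measurable_Cn. Qed.

Let Dmu : weight_on D mu. Proof. by case: aw. Qed.

Lemma ip_L2norm (f : fct) : L2norm D mu f = Num.sqrt (B f f).
Proof. by rewrite /B /ip wip_normc2. Qed.

Lemma bergman_semi_hilbert : semi_hilbert H B.
Proof.
case: aw => _ cl ev; exact: (@L2_subspace_semi_hilbert _ _ _ (@lebesgue_Cn R N)
  D mu mD Dmu (holomorphic D) (@holomorphic0 D) (@holomorphic_lin D) cl ev).
Qed.

Lemma bergman_eval_bounded z : D z -> exists C : R, forall h, H h ->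
  normc (h z) ^+ 2 <= C * B h h.
Proof.
case: aw => _ cl ev; exact: (@eval_bounded _ _ _ (@lebesgue_Cn R N)
  D mu mD Dmu (holomorphic D) (@holomorphic0 D) (@holomorphic_lin D) ev).
Qed.

Definition kernel_at (t : Cn R N) : fct := fun z => bergman_kernel D mu z t.

Definition kdiag t : R := re (bergman_kernel D mu t t).

Let sh := bergman_semi_hilbert.

Let evL z (a : R[i]) (f h : fct) : (a *: f + h) z = a * f z + h z.
Proof. by []. Qed.

(** The minimal element represents evaluation at [t] up to the factor [B psi psi], which the
    normalisation in [bergman_kernel] divides out. *)
Lemma kernel_reproducing t : D t -> H (kernel_at t) /\
  forall h, H h -> B h (kernel_at t) = re (h t).
Proof.
move=> Dt; have [C CP] := bergman_eval_bounded Dt.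
have [ne|em] := pselect (normalized_at D mu t !=set0); last first.
  have K0 : kernel_at t = 0.
    by apply/funext => z; rewrite /kernel_at /bergman_kernel asboolF.
  rewrite K0; split; first exact: (sh_zero sh).
  move=> h Hh; rewrite (sh_sym sh Hh (sh_zero sh)) (sh0l sh Hh).
  have [->//|ht0] := eqVneq (h t) 0.
  (* When no element is normalised at [t], every [h] vanishes there, and the zero kernel does
     reproduce. *)
  exfalso; apply: em; exists ((h t)^-1 *: (h : fct)); split.
    exact: (shZ sh).
  exact: mulVf.
have neM : minimal_at D mu t !=set0.
  have [f [Hf f1]] := ne.
  have [] := sh_exists_minimal sh (ell := fun f : fct => f t) (evL t) CP.
    by exists f.
  move=> phi [Hphi phi1 phimin]; exists phi; split => // g [Hg g1].
  by rewrite !ip_L2norm; exact: phimin.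
pose psi := xget (fun=> 0) (minimal_at D mu t).
have [[Hpsi psi1] psimin] : minimal_at D mu t psi by exact: xgetPex neM.
have rep := sh_minimal_representer sh (ell := fun f : fct => f t) (phi := psi)
  (evL t) Hpsi psi1.
have {}rep h : H h -> B h psi = re (h t) * B psi psi.
  by apply: rep => g Hg g1; have := psimin g (conj Hg g1); rewrite !ip_L2norm.
(* A null element would vanish at [t] by bounded evaluation, but [psi t = 1]. *)
have Q0 : B psi psi != 0.
  apply/eqP => q0; have := CP _ Hpsi; rewrite q0 mulr0 psi1 Normc.normc1 expr1n.
  by rewrite ler10.
have KE : kernel_at t = ((B psi psi)^-1)%:C *: (psi : fct).
  apply/funext => z; rewrite /kernel_at /bergman_kernel asboolT//.
  rewrite -/psi ip_L2norm sqr_sqrtr; last exact: (sh_ge0 sh).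
  by rewrite mulrC -fmorphV.
rewrite KE; split; first exact: (shZ sh).
move=> h Hh; have HZ := shZ sh ((B psi psi)^-1)%:C Hpsi.
rewrite (sh_sym sh Hh HZ) (shZl sh _ Hpsi Hh) (sh_sym sh Hpsi Hh) (rep _ Hh).
by rewrite mulrCA mulVf// mulr1.
Qed.

Lemma L2H_kernel_at t : D t -> H (kernel_at t).
Proof. by move/kernel_reproducing => []. Qed.

Lemma ip_kernel_at t h : D t -> H h -> B h (kernel_at t) = re (h t).
Proof. by move/kernel_reproducing => [_]; exact. Qed.

Lemma kdiagE t : D t -> kdiag t = B (kernel_at t) (kernel_at t).
Proof. by move=> Dt; rewrite (ip_kernel_at Dt (L2H_kernel_at Dt)). Qed.

Lemma kdiag_ge0 t : D t -> 0 <= kdiag t.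
Proof. by move=> Dt; rewrite kdiagE//; apply: (sh_ge0 sh); exact: L2H_kernel_at. Qed.

Lemma eval_le_kdiag z h : D z -> H h -> normc (h z) ^+ 2 <= B h h * kdiag z.
Proof.
move=> Dz Hh; rewrite kdiagE//.
exact: (sh_representer_le sh (ell := fun f : fct => f z) (evL z)
  (L2H_kernel_at Dz) (fun g Hg => ip_kernel_at Dz Hg) Hh).
Qed.

(* By the gliding hump the difference quotients of [t |-> kernel_at t], which
   are weakly bounded since every element of the space is differentiable, are
   bounded in norm. *)
Lemma kernel_at_lipschitz t : D t -> exists K dl : R, 0 < dl /\
  forall s, rnorm (s - t) < dl -> D s /\
    B (kernel_at s - kernel_at t) (kernel_at s - kernel_at t) <=
      K * rnorm (s - t) ^+ 2.
Proof.
move=> Dt; have /nbhs_rnormP[e0 e0_gt0 eD] : nbhs t D by exact: open_nbhs_nbhs.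
(* If no constant works, trying ((n+1) 3^n)^2 on balls of radius at most 1/(n+1) produces points
   [s n] tending to [t] whose difference quotients have norm above (n+1) 3^n. *)
apply: contrapT => noK.
have /choice[s sP] n : exists s, rnorm (s - t) < Num.min e0 n.+1%:R^-1 /\
    (n.+1%:R * 3 ^+ n) ^+ 2 * rnorm (s - t) ^+ 2 <
      B (kernel_at s - kernel_at t) (kernel_at s - kernel_at t).
  apply: contrapT => nos; apply: noK.
  exists ((n.+1%:R * 3 ^+ n) ^+ 2), (Num.min e0 n.+1%:R^-1).
  rewrite lt_min e0_gt0 invr_gt0 ltr0n; split => // s st.
  split; first by apply: eD; move: st; rewrite lt_min => /andP[].
  by rewrite leNgt; apply/negP => lt; apply: nos; exists s.
have Ds n : D (s n).
  by apply: eD; have [+ _] := sP n; rewrite lt_min => /andP[].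
have HK n : H (kernel_at (s n) - kernel_at t).
  by apply: (shB sh); exact: L2H_kernel_at.
have r0 n : 0 < rnorm (s n - t).
  apply: rnorm_gt0; apply/eqP => st; have [_] := sP n.
  have /eqP := st; rewrite subr_eq0 => /eqP ->.
  have -> : kernel_at t - kernel_at t = 0 by exact: subrr.
  rewrite (sh0l sh (sh_zero sh)).
  by rewrite ltNge mulr_ge0// sqr_ge0.
pose v n : fct := ((rnorm (s n - t))^-1)%:C *: (kernel_at (s n) - kernel_at t).
have Hv n : H (v n) by apply: (shZ sh).
have vn n : n.+1%:R * 3 ^+ n <= Num.sqrt (B (v n) (v n)).
  rewrite /v (sh_normZ sh _ (HK n)) normc_sqr/= expr0n/= addr0.
  rewrite -[leLHS]ger0_norm; last by rewrite mulr_ge0// exprn_ge0.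
  rewrite -sqrtr_sqr; apply: ler_wsqrtr; rewrite exprVn [leRHS]mulrC.
  by rewrite ler_pdivlMr ?exprn_gt0//; apply: ltW; have [] := sP n.
(* Pairing [x] with [v n] gives the real part of its difference quotient between [t] and [s n], of
   modulus at least (n+1)/2; this contradicts the Lipschitz bound of [x] at [t]. *)
have [x Hx xP] := sh_gliding_hump sh Hv vn.
have [K [dl [dl0 lip]]] := differentiable_lipschitz (Hx.1 _ Dt).
have [n1] : exists n, 0 + n.+1%:R^-1 < dl by exact: ltr_add_invr.
rewrite add0r => n1dl; have [n2 n2K] : exists n, 2 * K < n%:R.
  exists (Num.bound `|2 * K|); apply: le_lt_trans (ler_norm _) _.
  exact: archi_boundP.
pose n := maxn n1 n2; have := xP n.
have sn : rnorm (s n - t) < dl.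
  have [+ _] := sP n; rewrite lt_min => /andP[_ /lt_trans]; apply.
  by apply: le_lt_trans n1dl; rewrite lef_pV2 ?posrE// ler_nat ltnS leq_maxl.
have -> : B x (v n) = (re (x (s n)) - re (x t)) / rnorm (s n - t).
  have Ks := L2H_kernel_at (Ds n); have Kt := L2H_kernel_at Dt.
  rewrite (sh_sym sh Hx (Hv n)) (shZl sh _ (HK n) Hx) (shBl sh Ks Kt Hx).
  rewrite (sh_sym sh Ks Hx) (sh_sym sh Kt Hx).
  by rewrite (ip_kernel_at (Ds n) Hx) (ip_kernel_at Dt Hx) mulrC.
have -> : re (x (s n)) - re (x t) = re (x (s n) - x t).
  by case: (x (s n)) (x t) => [? ?] [? ?].
rewrite normrM normfV (gtr0_norm (r0 n)) mulrA ler_pdivlMr// => h.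
have := lip _ sn; have := normc_ge_re (x (s n) - x t).
have : 2 * K * rnorm (s n - t) < n.+1%:R * rnorm (s n - t).
  rewrite ltr_pM2r//; apply: lt_le_trans n2K _; rewrite ler_nat.
  by rewrite leqW// leq_maxr.
by move: h; move: (n.+1%:R * _) => p; lra.
Qed.

(** With r the distance from [s] to [t], the difference of squared norms is a quadratic term of
    order r^2 plus a cross term that Cauchy-Schwarz bounds by a multiple of r. *)
Lemma kdiag_continuous t : D t -> forall e : R, 0 < e ->
  \forall s \near t, D s /\ `|kdiag s - kdiag t| < e.
Proof.
move=> Dt e e0; have [K [dl [dl0 lip]]] := kernel_at_lipschitz Dt.
pose k := Num.sqrt (kdiag t); have k0 : 0 <= k by exact: sqrtr_ge0.
have k2 : k ^+ 2 = kdiag t by rewrite sqr_sqrtr// kdiag_ge0.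
(* [M >= 1] gives [M <= M ^+ 2], so the cross term is bounded by [M * r * k] without a square root
   of the constant. For r <= 1 the total is then at most [A * r]. *)
pose M := `|K| + 1; have M0 : 0 < M by have := normr_ge0 K; rewrite /M; lra.
have M1 : 1 <= M by have := normr_ge0 K; rewrite /M; lra.
have KM : K <= M by have := ler_norm K; rewrite /M; lra.
pose A := M * (1 + 2 * k); have A0 : 0 < A by rewrite mulr_gt0//; lra.
apply/nbhs_rnormP; exists (Num.min dl (Num.min 1 (e / A))).
  by rewrite !lt_min dl0 ltr01 divr_gt0.
move=> s; rewrite !lt_min => /and3P[sdl s1]; rewrite ltr_pdivlMr// => sA.
have [Ds le] := lip _ sdl; split => //.
have Ks := L2H_kernel_at Ds; have Kt := L2H_kernel_at Dt.
have Kst : H (kernel_at s - kernel_at t) by exact: (shB sh).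
set r := rnorm (s - t) in sdl s1 sA le.
have r0 : 0 <= r by exact: rnorm_ge0.
set q := B (kernel_at s - kernel_at t) (kernel_at s - kernel_at t) in le.
have q0 : 0 <= q by exact: (sh_ge0 sh).
have kE : kdiag s - kdiag t = q + 2 * B (kernel_at s - kernel_at t) (kernel_at t).
  by rewrite (kdiagE Dt) (kdiagE Ds); exact: (sh_quad_diff sh Ks Kt).
have cs := sh_cauchy_schwarz sh Kst Kt.
have qr : q <= M * r ^+ 2.
  by apply: le_trans le _; rewrite ler_wpM2r ?sqr_ge0.
have bb : `|B (kernel_at s - kernel_at t) (kernel_at t)| <= M * r * k.
  rewrite -(ler_pXn2r (_ : 0 < 2)%N) ?nnegrE ?mulr_ge0 ?(ltW M0)//.
  rewrite real_normK ?num_real//; apply: le_trans cs _.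
  rewrite -kdiagE// -k2 exprMn; apply: ler_wpM2r; first exact: sqr_ge0.
  apply: le_trans qr _; rewrite exprMn; apply: ler_wpM2r; first exact: sqr_ge0.
  by rewrite expr2 ler_peMl// ltW.
rewrite kE; apply: le_lt_trans (ler_normD _ _) _.
rewrite normrM (ger0_norm q0) (gtr0_norm (_ : 0 < 2)) //.
apply: le_lt_trans sA; rewrite /A.
have : r ^+ 2 <= r by rewrite expr2 ler_piMl// ltW.
move=> rr; have {}rr : M * r ^+ 2 <= M * r by rewrite ler_pM2l.
have fin (b x : R) : b <= M * r * k -> x <= M * r ^+ 2 ->
    x + 2 * b <= r * (M * (1 + 2 * k)).
  by move: rr; clear; lra.
exact: fin.
Qed.

End fixed_domain.

Lemma L2H_restrict D mu E nu (f : fct) : open D -> open E ->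
  admissible D mu -> admissible E nu -> E `<=` D ->
  (forall z, E z -> nu z <= mu z) -> L2H D mu f ->
  L2H E nu f /\ ip E nu f f <= ip D mu f f.
Proof.
move=> oD oE [Dmu _ _] [Enu _ _] ED numu [hf f2].
have [f2E le] := square_integrableS (open_measurable_Cn oD) (open_measurable_Cn oE)
  Dmu Enu ED numu f2.
by split => //; split => // z /ED; exact: hf.
Qed.

(** In the expanded square the cross term equals [kdiag D mu t] by the reproducing property on [E],
    and restriction to [E] bounds the squared norm of the larger kernel by that same number. *)
Lemma kernel_compare D mu E nu t : open D -> open E ->
  admissible D mu -> admissible E nu -> E `<=` D ->
  (forall z, E z -> nu z <= mu z) -> E t ->
  L2H E nu (kernel_at E nu t - kernel_at D mu t) /\
  ip E nu (kernel_at E nu t - kernel_at D mu t)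
          (kernel_at E nu t - kernel_at D mu t) <= kdiag E nu t - kdiag D mu t.
Proof.
move=> oD oE aD aE ED numu Et; have Dt := ED _ Et.
have KE := L2H_kernel_at oE aE Et; have KD := L2H_kernel_at oD aD Dt.
have [KD' le] := L2H_restrict oD oE aD aE ED numu KD.
have sh := bergman_semi_hilbert oE aE; split; first exact: (shB sh).
rewrite (sh_quadB sh KE KD') (sh_sym sh KE KD') (ip_kernel_at oE aE Et KD').
rewrite -/(kdiag D mu t) -(kdiagE oE aE Et).
by move: le; rewrite -(kdiagE oD aD Dt); lra.
Qed.

End bergman_space.

(** * Increasing families of weighted domains *)

Section increasing_chain.
Variables (R : realType) (N : nat).
Local Notation fct := (Cn R N -> R[i]^o).
Variables (D : set (Cn R N)) (mu : Cn R N -> R).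
Variables (E : nat -> set (Cn R N)) (nu : nat -> Cn R N -> R).
Hypotheses (oD : open D) (aD : admissible D mu).
Hypotheses (oE : forall i, open (E i)) (aE : forall i, admissible (E i) (nu i)).
Hypothesis EE : forall i j, (i <= j)%N -> E i `<=` E j.
Hypothesis nunu : forall i j, (i <= j)%N -> forall z, E i z -> nu i z <= nu j z.
Hypothesis DE : D = \bigcup_i E i.
Hypothesis nu_cvg : {ae @lebesgue_Cn R N, forall z, D z ->
  patch mu (E k) (nu k) z @[k --> \oo] --> mu z}.
Variable t : Cn R N.
Hypothesis E0t : E 0 t.

Let K j : fct := kernel_at (E j) (nu j) t.
Let k j : R := kdiag (E j) (nu j) t.
Let ED i : E i `<=` D. Proof. by rewrite DE => z Ez; exists i. Qed.
Let Et j : E j t. Proof. exact: (EE (leq0n j)). Qed.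

Let sh i : semi_hilbert (L2H (E i) (nu i) : set fct) (ip (E i) (nu i)).
Proof. exact: bergman_semi_hilbert. Qed.

Let HK i j : (i <= j)%N -> L2H (E i) (nu i) (K j).
Proof.
move=> ij; have := L2H_kernel_at (@oE j) (aE j) (Et j).
by move/(L2H_restrict (@oE j) (@oE i) (aE j) (aE i) (EE ij) (nunu ij)) => [].
Qed.

Let compare i p q : (i <= p)%N -> (p <= q)%N ->
  ip (E i) (nu i) (K p - K q) (K p - K q) <= k p - k q.
Proof.
move=> ip pq.
have [Hpq le] := kernel_compare (@oE q) (@oE p) (aE q) (aE p) (EE pq) (nunu pq) (Et p).
apply: le_trans le.
by have [] := L2H_restrict (@oE p) (@oE i) (aE p) (aE i) (EE ip) (nunu ip) Hpq.
Qed.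

Let k_nincr p q : (p <= q)%N -> k q <= k p.
Proof.
move=> pq; have := compare (leqnn p) pq.
have := sh_ge0 (sh p) (shB (sh p) (HK (leqnn p)) (HK pq)).
by move=> h1 h2; have := le_trans h1 h2; rewrite subr_ge0.
Qed.

Let k_ge0 p : 0 <= k p. Proof. exact: (kdiag_ge0 (@oE p) (aE p) (Et p)). Qed.

Let k_cvg : exists l : R, k j @[j --> \oo] --> l.
Proof.
apply/cvg_ex; apply: nonincreasing_is_cvgn; first by move=> p q; exact: k_nincr.
by exists 0 => _ [p _ <-].
Qed.

(** The diagonal values decrease to a limit, so [compare] makes the kernels Cauchy in the i-th
    space. Bounded evaluation turns norm convergence into pointwise convergence, which identifies
    the limits for different [i] on common points. *)
Let chain_limit i : exists2 g : fct, L2H (E i) (nu i) g &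
  forall z, E i z -> re (K j z) @[j --> \oo] --> re (g z) /\
                     im (K j z) @[j --> \oo] --> im (g z).
Proof.
have Hu n : L2H (E i) (nu i) (K (i + n)%N) by exact: HK (leq_addr n i).
have [l kl] := k_cvg.
have kc (e : R) : 0 < e -> exists n, forall p, (n <= p)%N -> `|l - k p| < e.
  by move=> e0; have /cvgrPdist_lt/(_ e e0)[n _ nP] := kl; exists n.
have [g Hg gP] : exists2 g : fct, L2H (E i) (nu i) g &
    converges_for (ip (E i) (nu i)) (fun n => K (i + n)%N) g.
  apply: (sh_complete (sh i) Hu) => e e0.
  have e2 : 0 < e / 2 by lra.
  have [n nP] := kc _ e2; exists n.
  have small p q : (n <= p)%N -> (p <= q)%N ->
      ip (E i) (nu i) (K (i + p)%N - K (i + q)%N) (K (i + p)%N - K (i + q)%N) < e.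
    move=> np pq; have ipq : (i + p <= i + q)%N by rewrite leq_add2l.
    apply: le_lt_trans (compare (leq_addr p i) ipq) _.
    have := nP _ (leq_trans np (leq_addl i p)).
    have := nP _ (leq_trans (leq_trans np pq) (leq_addl i q)).
    move: (k (i + p)%N) (k (i + q)%N) => a b.
    by rewrite !ltr_norml => /andP[? ?] /andP[? ?]; lra.
  move=> p q np nq; have [pq|/ltnW qp] := leqP p q; first exact: small.
  apply: le_lt_trans (small q p nq qp).
  by rewrite (sh_quadBC (sh i) (Hu p) (Hu q)).
exists g => // z Ez; pose c := kdiag (E i) (nu i) z.
have c0 : 0 <= c by exact: (kdiag_ge0 (@oE i) (aE i) Ez).
have near_z (e : R) : 0 < e ->
    exists n, forall p, (n <= p)%N -> normc (K p z - g z) < e.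
  move=> e0; have c1 : 0 < c + 1 by lra.
  have [n nP] := gP _ (divr_gt0 (exprn_gt0 2 e0) c1).
  exists (i + n)%N => p inp; have -> : p = (i + (p - i))%N.
    by rewrite subnKC// (leq_trans (leq_addr n i)).
  have np : (n <= p - i)%N by rewrite leq_subRL// (leq_trans (leq_addr n i)).
  have HB := shB (sh i) (Hu (p - i)%N) Hg.
  have := nP _ np; rewrite ltr_pdivlMr// => lt.
  rewrite -(ltr_pXn2r (_ : 0 < 2)%N) ?nnegrE ?normc_ge0 ?ltW//.
  apply: le_lt_trans (eval_le_kdiag (@oE i) (aE i) Ez HB) _.
  apply: le_lt_trans lt; apply: ler_wpM2l; last by rewrite -/c lerDl.
  exact: (sh_ge0 (sh i) HB).
have ReB (a b : R[i]) : re (a - b) = re a - re b by case: a b => [? ?] [? ?].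
have ImB (a b : R[i]) : im (a - b) = im a - im b by case: a b => [? ?] [? ?].
split; apply/cvgrPdist_lt => e e0; have [n nP] := near_z e e0; exists n => // p np.
  by rewrite distrC -ReB; apply: le_lt_trans (normc_ge_re _) (nP _ np).
by rewrite distrC -ImB; apply: le_lt_trans (normc_ge_im _) (nP _ np).
Qed.

Let g : fct := fun z =>
  lim (re (K j z) @[j --> \oo]) +i* lim (im (K j z) @[j --> \oo]).

Let gE i gi : (forall z, E i z -> re (K j z) @[j --> \oo] --> re (gi z) /\
  im (K j z) @[j --> \oo] --> im (gi z)) -> forall z, E i z -> g z = gi z.
Proof.
move=> giP z Ez; have [rz iz] := giP z Ez; rewrite /g.
by rewrite (cvg_lim _ rz)// (cvg_lim _ iz)//; case: (gi z).
Qed.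

Let g_cvg z : D z -> re (K j z) @[j --> \oo] --> re (g z) /\
  im (K j z) @[j --> \oo] --> im (g z).
Proof.
rewrite DE => -[i _ Ez]; have [gi _ giP] := chain_limit i.
by rewrite (gE giP Ez); exact: giP.
Qed.

Let mE i : measurable (E i). Proof. exact: open_measurable_Cn. Qed.
Let mD : measurable D. Proof. exact: open_measurable_Cn. Qed.

Let ghol : holomorphic D g.
Proof.
rewrite DE => z [i _ Ez]; have [gi [hgi _] giP] := chain_limit i.
apply: (near_eq_differentiable _ (hgi z Ez)).
have := open_nbhs_nbhs (conj (@oE i) Ez).
by apply: filterS => s Es; rewrite (gE giP Es).
Qed.

Let mgr : measurable_fun D (fun z => re (g z)).
Proof.
rewrite DE; apply/(measurable_fun_bigcup _ mE) => i.
have [gi [_ [mr _ _]] giP] := chain_limit i.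
by apply: eq_measurable_fun mr => z /set_mem Ez; rewrite (gE giP Ez).
Qed.

Let mgi : measurable_fun D (fun z => im (g z)).
Proof.
rewrite DE; apply/(measurable_fun_bigcup _ mE) => i.
have [gi [_ [_ mi _]] giP] := chain_limit i.
by apply: eq_measurable_fun mi => z /set_mem Ez; rewrite (gE giP Ez).
Qed.

Let Dmu : weight_on D mu. Proof. by case: aD. Qed.
Let Enu i : weight_on (E i) (nu i). Proof. by case: (aE i). Qed.

(** The n-th integrand is the squared kernel of index [J + n] with its own weight, extended by zero
    to [D]; its integral is [k (J + n) <= k J]. Each point of [D] eventually lies in the chain, so
    the zero extension does not affect the limit. *)
Let gint J : (\int[@lebesgue_Cn R N]_(z in D) (normc (g z) ^+ 2 * mu z)%:E <=
  (k J)%:E)%E.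
Proof.
pose F n z : R := ((fun z => normc (K (J + n)%N z) ^+ 2 * nu (J + n)%N z) \_
  (E (J + n)%N)) z.
apply: (@fatou_le _ _ _ (@lebesgue_Cn R N) D F _ _ mD).
- move=> n; have [_ [mr mi _]] := HK (leqnn (J + n)%N).
  apply/(measurable_restrict _ (mE _) mD); rewrite setIidr; last exact: ED.
  exact: (measurable_normc2 (Enu _) mr mi).
- exact: (measurable_normc2 Dmu mgr mgi).
- move=> n z Dz; rewrite /F /patch; case: ifPn => // /set_mem Ez.
  by rewrite mulr_ge0 ?sqr_ge0// ltW// (Enu _).2.
- by move=> z Dz; rewrite mulr_ge0 ?sqr_ge0// ltW// Dmu.2.
- move: nu_cvg; apply: filterS => z nuz Dz; have [rz iz] := g_cvg Dz.
  have shift (a : nat -> R) (b : R) : a j @[j --> \oo] --> b ->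
      a (J + j)%N @[j --> \oo] --> b.
    by move=> al; rewrite -(cvg_shiftn J) in al; under eq_fun do rewrite addnC.
  have sq (a : nat -> R) (b : R) : a j @[j --> \oo] --> b ->
      a j ^+ 2 @[j --> \oo] --> b ^+ 2.
    by move=> al; rewrite expr2; under eq_fun do rewrite expr2; exact: cvgM.
  have lim := cvgM (cvgD (sq _ _ (shift _ _ rz)) (sq _ _ (shift _ _ iz)))
    (shift _ _ (nuz Dz)).
  have near_F : \forall n \near \oo,
      (re (K (J + n)%N z) ^+ 2 + im (K (J + n)%N z) ^+ 2) *
      patch mu (E (J + n)%N) (nu (J + n)%N) z = F n z.
    move: (Dz); rewrite DE => -[i _ Ez]; exists i => // n /= lein.
    have EJ : z \in E (J + n)%N.
      by apply/mem_set; apply: EE Ez; exact: leq_trans lein (leq_addl _ _).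
    by rewrite /F /patch EJ normc_sqr.
  by rewrite normc_sqr; exact: (cvg_trans (near_eq_cvg near_F) (lim _ _)).
- move=> n; rewrite (_ : (fun z => (F n z)%:E) =
    (fun z => (normc (K (J + n)%N z) ^+ 2 * nu (J + n)%N z)%:E) \_ (E (J + n)%N)).
    rewrite -integral_mkcondr setIidr; last exact: ED.
    have [_ K2] := HK (leqnn (J + n)%N).
    rewrite (wip_EFin (mE _) (Enu _) K2) lee_fin.
    apply: le_trans (k_nincr (leq_addr n J)).
    by rewrite /k [leRHS](kdiagE (@oE _) (aE _) (Et _)).
  by apply/funext => z; rewrite /F /patch; case: ifP.
Qed.

(** Cauchy-Schwarz for [g] and the kernel of [D] gives l^2 <= k_J k_D for every [J]; letting [J]
    grow and cancelling l yields l <= k_D. *)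
Lemma kdiag_chain_lt (e : R) : 0 < e ->
  exists j, kdiag (E j) (nu j) t < kdiag D mu t + e.
Proof.
move=> e0; have [l kl] := k_cvg.
have Hg : L2H D mu g.
  split; first exact: ghol.
  split; [exact: mgr|exact: mgi|].
  by apply: le_lt_trans (gint 0%N) _; rewrite ltry.
have gle J : ip D mu g g <= k J by rewrite -lee_fin -(wip_EFin mD Dmu Hg.2).
have Dt : D t by exact: ED E0t.
have gt : re (g t) = l.
  by have [rt _] := g_cvg Dt; apply: (cvg_unique _ rt).
have shD := bergman_semi_hilbert oD aD.
pose kD := kdiag D mu t; have kD0 : 0 <= kD by exact: (kdiag_ge0 oD aD Dt).
have lJ J : l ^+ 2 <= k J * kD.
  have KD := L2H_kernel_at oD aD Dt.
  have := sh_cauchy_schwarz shD Hg KD.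
  rewrite (ip_kernel_at oD aD Dt Hg) gt -(kdiagE oD aD Dt) => /le_trans; apply.
  exact: ler_wpM2r kD0 _ _ (gle J).
have l0 : 0 <= l by apply: (cvgr_to_ge kl); exact: nearW.
have ll : l ^+ 2 <= l * kD.
  apply: le_eps => d d0; have kD1 : 0 < kD + 1 by lra.
  have /cvgrPdist_lt/(_ _ (divr_gt0 d0 kD1))[n _ /(_ n (leqnn n))] := kl.
  rewrite /= ltr_pdivlMr// => lt; apply: le_trans (lJ n) _.
  rewrite distrC in lt.
  have fin (a b c : R) : 0 <= c -> 0 <= a -> b - l <= a -> a * (c + 1) < d ->
      b * c <= l * c + d.
    by move=> *; nra.
  by apply: fin lt => //; exact: ler_norm.
have lk : l <= kD.
  have [->//|l1] := eqVneq l 0.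
  by rewrite -(ler_pM2l (_ : 0 < l)) ?lt_def ?l1// -expr2.
have /cvgrPdist_lt/(_ _ e0)[n _ /(_ n (leqnn n))] := kl.
rewrite /= ltr_norml => /andP[le _]; exists n; rewrite -/kD -/(k n).
by move: le; move: (k n) => b; lra.
Qed.

End increasing_chain.

(** * From chains to general exhaustions, and local estimates *)

Section exhaustion.
Variables (R : realType) (N : nat).
Local Notation fct := (Cn R N -> R[i]^o).
Variables (D_ : nat -> set (Cn R N)) (D : set (Cn R N)).
Variables (mu : Cn R N -> R) (mu_ : nat -> Cn R N -> R).
Hypotheses (oD : open D) (aD : admissible D mu).
Hypotheses (oD_ : forall k, open (D_ k)) (aD_ : forall k, admissible (D_ k) (mu_ k)).
Hypothesis DE : D = \bigcup_k D_ k.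
Variable rank : nat -> nat.
Hypothesis D_sub : forall n m, (rank n <= m)%N -> D_ n `<=` D_ m.
Hypothesis mu_le : forall n m, (rank n <= m)%N ->
  forall z, D_ n z -> mu_ n z <= mu_ m z /\ mu_ m z <= mu z.
Hypothesis mu_cvg : {ae @lebesgue_Cn R N, forall z, D z ->
  patch mu (D_ k) (mu_ k) z @[k --> \oo] --> mu z}.

Let D_D n : D_ n `<=` D. Proof. by rewrite DE => z Dz; exists n. Qed.

Let mu_le_mu n z : D_ n z -> mu_ n z <= mu z.
Proof. by move=> Dz; have [h1 h2] := mu_le (leqnn (rank n)) Dz; exact: le_trans h2. Qed.

(** Consecutive domains need not be nested. The indices [s], each beyond the [rank] of its
    predecessor, form a genuine chain; it starts late enough to exceed [M] and to contain [t]. *)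
Lemma kdiag_exhaustion_lt M n t (e : R) : D_ n t -> 0 < e ->
  exists m, [/\ (M <= m)%N, D_ m t & kdiag (D_ m) (mu_ m) t < kdiag D mu t + e].
Proof.
move=> Dnt e0.
pose fix s j : nat :=
  if j is i.+1 then maxn (s i).+1 (rank (s i)) else maxn M (rank n).
have sS i : s i.+1 = maxn (s i).+1 (rank (s i)) by [].
have step i : D_ (s i) `<=` D_ (s i.+1) by apply: D_sub; rewrite sS leq_maxr.
have stepmu i z : D_ (s i) z -> mu_ (s i) z <= mu_ (s i.+1) z.
  by move=> Dz; have [] := mu_le (leq_maxr (s i).+1 (rank (s i))) Dz.
have chain i j : (i <= j)%N ->
    D_ (s i) `<=` D_ (s j) /\ forall z, D_ (s i) z -> mu_ (s i) z <= mu_ (s j) z.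
  move=> ij; rewrite -(subnKC ij); elim: (j - i)%N => [|p [IH1 IH2]].
    by rewrite addn0; split => // z _.
  rewrite addnS; split; first exact: subset_trans IH1 (step _).
  by move=> z Dz; apply: le_trans (IH2 z Dz) (stepmu _ _ (IH1 _ Dz)).
have s_ge i : (M + i <= s i)%N.
  elim: i => [|i IH]; first by rewrite addn0 leq_maxl.
  by rewrite addnS sS leq_max ltnS IH.
(* As [s i >= i], each [D_ p] lies in the chain member of index [rank p]. *)
have cover : D = \bigcup_i D_ (s i).
  apply/seteqP; split; last by move=> z [i _ /D_D].
  rewrite DE => z [p _ Dz]; exists (rank p) => //; apply: D_sub Dz.
  by apply: leq_trans (s_ge _); exact: leq_addl.
have s_cvg : {ae @lebesgue_Cn R N, forall z, D z ->
    patch mu (D_ (s k)) (mu_ (s k)) z @[k --> \oo] --> mu z}.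
  move: mu_cvg; apply: filterS => z muz Dz A nA.
  have [p _ pA] := muz Dz A nA; exists p => // k /= pk; apply: pA => /=.
  by apply: leq_trans pk _; apply: leq_trans (s_ge _); exact: leq_addl.
have st : D_ (s 0%N) t by apply: D_sub Dnt; exact: leq_maxr.
have [j jP] := @kdiag_chain_lt _ _ D mu (fun i => D_ (s i)) (fun i => mu_ (s i))
  oD aD (fun i => @oD_ (s i)) (fun i => aD_ (s i)) (fun i j ij => (chain i j ij).1)
  (fun i j ij => (chain i j ij).2) cover s_cvg t st e e0.
exists (s j); split => //; first by apply: leq_trans (s_ge _); exact: leq_addr.
by apply: (chain 0%N j (leq0n j)).1.
Qed.

(** Two auxiliary indices stay fixed while [m] varies: [n] controls evaluation at [z], and [p]
    controls the norm of the kernel difference at [t]. *)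
Lemma bergman_kernel_local z0 t0 (e : R) : D z0 -> D t0 -> 0 < e ->
  exists U V : set (Cn R N), [/\ nbhs z0 U, nbhs t0 V &
    exists M, forall m z t, (M <= m)%N -> U z -> V t ->
      [/\ D_ m z, D_ m t & normc (bergman_kernel (D_ m) (mu_ m) z t -
                                  bergman_kernel D mu z t) < e]].
Proof.
have fin (d a b v v' u : R) : a < v + d -> b - a < d -> - d < v' - v ->
    u <= b -> u - v' < 3 * d.
  by move=> ? ? ? ?; lra.
move=> Dz0 Dt0 e0.
have [n Dnz Dnt] : exists2 n, D_ n z0 & D_ n t0.
  move: Dz0 Dt0; rewrite DE => -[a _ az] [b _ bt]; exists (maxn (rank a) (rank b)).
    by apply: D_sub az; exact: leq_maxl.
  by apply: D_sub bt; exact: leq_maxr.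
(* By continuity [c] bounds the diagonal kernel of index [n] near [z0]. *)
pose c := kdiag (D_ n) (mu_ n) z0 + 1.
have c0 : 0 < c by have := kdiag_ge0 (@oD_ n) (aD_ n) Dnz; rewrite /c; lra.
(* Three errors of size [dl] occur: the gap between the diagonals of [p] and [D] at [t0], and the
   variation of each between [t0] and [t]. Thus [3 * dl * c = e ^+ 2]. *)
pose dl := e ^+ 2 / (3 * c).
have dl0 : 0 < dl by rewrite divr_gt0 ?exprn_gt0// mulr_gt0.
have [p [np Dpt kp]] := kdiag_exhaustion_lt (rank n) Dnt dl0.
have Uz := kdiag_continuous (@oD_ n) (aD_ n) Dnz ltr01.
have Vp := kdiag_continuous (@oD_ p) (aD_ p) Dpt dl0.
have VD := kdiag_continuous oD aD Dt0 dl0.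
have Vn : nbhs t0 (D_ n) by apply: open_nbhs_nbhs; split; [exact: oD_|].
exists [set z | D_ n z /\ `|kdiag (D_ n) (mu_ n) z - kdiag (D_ n) (mu_ n) z0| < 1].
exists [set t | [/\ D_ n t, D_ p t,
  `|kdiag (D_ p) (mu_ p) t - kdiag (D_ p) (mu_ p) t0| < dl &
  `|kdiag D mu t - kdiag D mu t0| < dl]].
split; first exact: Uz.
  by move: Vn Vp VD; apply: filterS3 => t ? [? ?] [? ?]; split.
exists (maxn (rank n) (rank p)) => m z t; rewrite geq_max => /andP[nm pm].
move=> [Dz kz] [Dnt' Dpt' kpt kt].
have Dmz := D_sub nm Dz; have Dmt := D_sub nm Dnt'; split => //.
have [HB leB] := kernel_compare oD (@oD_ m) aD (aD_ m) (@D_D m) (@mu_le_mu m) Dmt.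
have mu_n x : D_ n x -> mu_ n x <= mu_ m x by move=> Dx; have [] := mu_le nm Dx.
have mu_p x : D_ p x -> mu_ p x <= mu_ m x by move=> Dx; have [] := mu_le pm Dx.
have [HBn leBn] :=
  L2H_restrict (@oD_ m) (@oD_ n) (aD_ m) (aD_ n) (D_sub nm) mu_n HB.
(* Comparing [m] with [p] serves only to show that the diagonal of index [m] at [t] is at most that
   of index [p]. *)
have [HBp leBp] :=
  kernel_compare (@oD_ m) (@oD_ p) (aD_ m) (aD_ p) (D_sub pm) mu_p Dpt'.
have B0 := sh_ge0 (bergman_semi_hilbert (@oD_ p) (aD_ p)) HBp.
have Bn0 := sh_ge0 (bergman_semi_hilbert (@oD_ n) (aD_ n)) HBn.
rewrite -(ltr_pXn2r (_ : 0 < 2)%N) ?nnegrE ?normc_ge0 ?ltW//.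
apply: le_lt_trans (eval_le_kdiag (@oD_ n) (aD_ n) Dz HBn) _.
have e2 : e ^+ 2 = 3 * dl * c by rewrite /dl; field; rewrite gt_eqF.
have lt3 := le_trans leBn (le_trans leB (lexx _)).
have {}lt3 : ip (D_ n) (mu_ n) (kernel_at (D_ m) (mu_ m) t - kernel_at D mu t)
    (kernel_at (D_ m) (mu_ m) t - kernel_at D mu t) < 3 * dl.
  apply: le_lt_trans lt3 _; have := le_trans B0 leBp; rewrite subr_ge0.
  move: kp kpt kt; rewrite !ltr_norml => kp /andP[_ kpt] /andP[kt _] mp.
  exact: fin kp kpt kt mp.
have kz0 := kdiag_ge0 (@oD_ n) (aD_ n) Dz.
have kzc : kdiag (D_ n) (mu_ n) z < c.
  by move: kz; rewrite /c ltr_norml => /andP[_]; rewrite ltrBlDl.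
rewrite e2; exact: ltr_pM.
Qed.

End exhaustion.

Theorem theorem4 (R : realType) (N : nat) (N_gt0 : (0 < N)%N)
  (D_ : nat -> set (Cn R N)) (D_domain : forall k, domain (D_ k))
  (D : set (Cn R N)) (D_def : D = \bigcup_k D_ k)
  (mu : Cn R N -> R) (mu_AW : admissible D mu)
  (mu_ : nat -> Cn R N -> R) (mu_k_AW : forall k, admissible (D_ k) (mu_ k))
  (hypA : forall n, exists Nn, forall m, (Nn <= m)%N ->
     D_ n `<=` D_ m /\
     forall z, D_ n z -> mu_ n z <= mu_ m z /\ mu_ m z <= mu z)
  (hypB : {ae @lebesgue_Cn R N, forall z, D z ->
     patch mu (D_ k) (mu_ k) z @[k --> \oo] --> mu z}) :
  forall F : set (Cn R N * Cn R N), compact F -> F `<=` D `*` D ->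
    (\forall k \near \oo, F `<=` D_ k `*` D_ k) /\
    {uniform F, (fun k (p : Cn R N * Cn R N) =>
                   bergman_kernel (D_ k) (mu_ k) p.1 p.2 : R[i]^o) @ \oo -->
                (fun p : Cn R N * Cn R N =>
                   bergman_kernel D mu p.1 p.2 : R[i]^o)}.
Proof.
move=> F cF FD.
have oD_ k : open (D_ k) by case: (D_domain k).
have oD : open D by rewrite D_def; apply: bigcup_open.
have [rank rankP] := choice hypA.
have near_F (e : R) : 0 < e -> \forall k \near \oo, F `<=` [set p |
    [/\ D_ k p.1, D_ k p.2 & normc (bergman_kernel (D_ k) (mu_ k) p.1 p.2 -
                                    bergman_kernel D mu p.1 p.2) < e]].
  (* Compactness merges the local thresholds [M] into a single one valid on all of [F]. *)
  move=> e0; have /compact_near_coveringP := cF; apply => -[z0 t0] /FD[/= Dz Dt].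
  have [U [V [nU nV [M MP]]]] := bergman_kernel_local oD mu_AW oD_ mu_k_AW D_def
    (fun n m nm => (rankP n m nm).1) (fun n m nm => (rankP n m nm).2) hypB Dz Dt e0.
  exists (U `*` V, [set k | (M <= k)%N]).
    by split => /=; [exists (U, V)|exists M].
  by move=> [[z t] k] [[/= Uz Vt] Mk]; exact: MP.
split.
  have := near_F 1 ltr01; apply: filterS => k Fk p /Fk [Dz Dt _].
  by split.
move=> P /uniform_nbhs[E [entE EP]].
(* An entourage contains a ball entourage whose radius is a positive element of [R[i]], hence real;
   its real part is the tolerance passed to [near_F]. *)
have : entourage_ (@ball _ R[i]^o) E by rewrite entourage_ballE.
move=> [e /= /pos_complexE[eE e0] eball].
have := near_F (re e) e0; apply: filterS => k Fk.
apply: EP => p Fp; apply: eball => /=.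
have [_ _ lt] := Fk _ Fp.
by rewrite -ball_normE/= distrC eE normC_normc ltcR.
Qed.
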